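(* Let $n\ge 1$, let $V\subset\mathbb{R}^{n,n}$ be a fixed non-degenerate linear subspace of dimension $n$, and fix an anti-isometry $\sigma:V\to V^\perp$. The map $\gamma:\mathcal{R}\to\mathcal{T}$, $\Gamma\mapsto(\Gamma_L,\Gamma_R(-1),\varphi)$, descends to injections $$\overline{\mathcal{R}}\hookrightarrow\overline{\mathcal{T}},\qquad \overline{\mathcal{R}}/\sigma\hookrightarrow\overline{\mathcal{T}}/\sigma .$$ The image $\gamma(\overline{\mathcal{R}})$ consists exactly of the classes of triples $(X,Y,\varphi)$ such that $X$ has the same signature as $V$.
   Context: All lattices are even integral and non-degenerate: free abelian groups of finite rank with a non-degenerate symmetric integral bilinear form $\langle\cdot,\cdot\rangle$ with $\langle x,x\rangle\in2\mathbb{Z}$. $X(-1)$ is $X$ with the form negated. $X^*$ is the dual lattice, $A_X=X^*/X$ the discriminant group with its induced $\mathbb{Q}/2\mathbb{Z}$-valued quadratic form; isometries of discriminant groups are group isomorphisms preserving this form. For a lattice isomorphism $f:X\to X'$, $f^*:A_X\to A_{X'}$ denotes the induced isometry. $\mathbb{R}^{n,n}$ is $\mathbb{R}^{2n}$ with $\langle x,x\rangle=x_1^2+\dots+x_n^2-x_{n+1}^2-\dots-x_{2n}^2$. $V^\perp$ is the orthogonal complement of $V$ in $\mathbb{R}^{n,n}$. If $V$ has signature $(p,n-p)$, then $V^\perp$ has signature $(n-p,p)$, so an anti-isometry $\sigma:V\to V^\perp$ exists. It is extended to the involutive anti-isometry $\sigma:\mathbb{R}^{n,n}\to\mathbb{R}^{n,n}$,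 $(x,y)\mapsto(\sigma^{-1}y,\sigma x)$ for $(x,y)\in V\oplus V^\perp$. A Narain lattice is an even unimodular lattice $\Gamma\subset\mathbb{R}^{n,n}$ of signature $(n,n)$. Put $\Gamma_L=\Gamma\cap V$, $\Gamma_R=\Gamma\cap V^\perp$. $\Gamma$ is $V$-rational if $\operatorname{rank}\Gamma_L=\dim V$. $\mathcal{R}$ is the set of $V$-rational Narain lattices. $\Gamma,\Gamma'$ are $V$-equivalent if $\Gamma'=g\Gamma$ for some $g\in O(V)\times O(V^\perp)\subset O(\mathbb{R}^{n,n})$; $\overline{\mathcal{R}}$ is the set of $V$-equivalence classes in $\mathcal{R}$. The map $\Gamma\mapsto\sigma\Gamma$ induces an involution $\sigma$ on $\mathcal{R}$ and on $\overline{\mathcal{R}}$. A triple $(X,Y,\varphi)$ consists of even lattices $X,Y$ of rank $n$ having the same signature, and an isometry $\varphi:A_Y\to A_X$. $\mathcal{T}$ is the collection of triples. $(X,Y,\varphi)$ and $(X',Y',\varphi')$ are properly equivalent if there are isomorphisms of lattices $f:X\to X'$, $g:Y\to Y'$ with $\varphi'=f^*\circ\varphi\circ(g^* )^{-1}$; $\overline{\mathcal{T}}$ is the set of proper equivalence classes. The involution $\sigma$ on $\mathcal{T}$ and $\overline{\mathcal{T}}$ is $(X,Y,\varphi)\mapsto(Y,X,\varphi^{-1})$. For $\Gamma\in\mathcal{R}$, the isometry $\varphi:A_{\Gamma_R(-1)}\to A_{\Gamma_L}$ in $\gamma(\Gamma)$ is the unique one with $\Gamma/(\Gamma_L\oplus\Gamma_R)=\{\varphi(a)\oplus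 a\mid a\in\Gamma_R(-1)^*/\Gamma_R(-1)\}$, where $\Gamma_R(-1)^*$ is identified as a group with $\Gamma_R^*$. The quotient of a set by $\sigma$ is its set of orbits under the involution $\sigma$. *)

(* Defs.v *)
From HB Require Import structures.
From mathcomp Require Import all_boot all_order all_algebra.
From mathcomp Require Import boolp classical_sets functions reals.
From mathcomp Require Import ring generic_quotient ring_quotient sesquilinear.

Set Implicit Arguments.
Unset Strict Implicit.
Unset Printing Implicit Defensive.

Import Order.TTheory GRing.Theory Num.Theory.

Local Open Scope ring_scope.
Local Open Scope quotient_scope.

(* The set of equivalence classes of [e], as a type, with its projection [cls].
   [e] is meant to be an equivalence relation. *)
Definition quotient (T : Type) (e : T -> T -> Prop) : Type :=
  {C : T -> Prop | exists x, C = e x}.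

Definition cls (T : Type) (e : T -> T -> Prop) (x : T) : quotient e :=
  exist _ (e x) (ex_intro _ x erefl).

Definition is_equiv (T : Type) (e : T -> T -> Prop) : Prop :=
  [/\ forall x, e x x, forall x y, e x y -> e y x
    & forall x y z, e x y -> e y z -> e x z].

Lemma quotient_map_subproof (T : Type) (e : T -> T -> Prop) (s : T -> T)
    (he : is_equiv e) (hs : forall x y, e x y -> e (s x) (s y))
    (C : quotient e) :
  exists x, (fun y => exists2 z, sval C z & e (s z) y) = e x.
Proof.
case: he => er es et; case: C => C [x hx] /=; rewrite hx; exists (s x).
apply/funext => y; apply/propext; split.
  by case=> z /hs xz; apply: et.
by move=> sxy; exists x.
Qed.

Definition quotient_map (T : Type) (e : T -> T -> Prop) (s : T -> T)
    (he : is_equiv e) (hs : forall x y, e x y -> e (s x) (s y))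
    (C : quotient e) : quotient e :=
  exist _ _ (quotient_map_subproof he hs C).

Lemma quotient_mapE (T : Type) (e : T -> T -> Prop) (s : T -> T)
    (he : is_equiv e) (hs : forall x y, e x y -> e (s x) (s y)) (x : T) :
  quotient_map he hs (cls e x) = cls e (s x).
Proof.
apply: eq_exist => /=; apply/funext => y; apply/propext.
case: he => er _ et; split; last by move=> sxy; exists x.
by case=> z /hs xz; apply: et.
Qed.

(* Only used for an involution [s], whose orbits are the sets {c, s c}. *)
Definition same_orbit (T : Type) (s : T -> T) (c d : T) : Prop :=
  d = c \/ d = s c.

Definition orbit_space (T : Type) (s : T -> T) : Type :=
  quotient (same_orbit s).

Record preLattice : Type := PreLattice {
  pl_sort :> zmodType;
  pl_form : pl_sort -> pl_sort -> int;
  pl_formC : forall x y, pl_form x y = pl_form y x;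
  pl_formB : forall x y z, pl_form (x - y) z = pl_form x z - pl_form y z }.

Arguments pl_form {_}.

Section FormTheory.
Variable X : preLattice.
Implicit Types x y z : X.

Lemma pl_form0l z : pl_form (0 : X) z = 0.
Proof. by rewrite -(subrr (0 : X)) pl_formB subrr. Qed.

Lemma pl_formNl x z : pl_form (- x) z = - pl_form x z.
Proof. by rewrite -[- x]sub0r pl_formB pl_form0l sub0r. Qed.

Lemma pl_formDl x y z : pl_form (x + y) z = pl_form x z + pl_form y z.
Proof. by rewrite -[y in LHS]opprK pl_formB pl_formNl opprK. Qed.

Lemma pl_formDr x y z : pl_form z (x + y) = pl_form z x + pl_form z y.
Proof. by rewrite ![pl_form z _]pl_formC pl_formDl. Qed.

End FormTheory.

Lemma zmod_morphismMz (A : zmodType) (f : A -> int) (m : int) (x : A) :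
  zmod_morphism f -> f (x *~ m) = m * f x.
Proof.
move=> fB; pose F := GRing.isZmodMorphism.Build A int f fB.
pose g : {additive A -> int} := HB.pack f F.
by rewrite -[LHS]/(g (x *~ m)) raddfMz -mulrzr intz mulrC.
Qed.

Definition zbasis (A : zmodType) (r : nat) (b : 'I_r -> A) : Prop :=
  forall x : A, exists! c : 'rV[int]_r, x = \sum_i b i *~ c 0 i.

(* The underlying group is free abelian of rank [r]. *)
Definition lat_rank (X : preLattice) (r : nat) : Prop :=
  exists b : 'I_r -> X, zbasis b.

Definition even_lattice (X : preLattice) : Prop :=
  [/\ exists r, lat_rank X r,
      forall x : X, (2 %| pl_form x x)%Z
    & forall x : X, (forall y : X, pl_form x y = 0) -> x = 0].

Record evenLattice : Type := EvenLattice {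
  el_pre :> preLattice;
  el_even : even_lattice el_pre }.

(* Sylvester's law of inertia: [p] and [q] are determined by [G]. *)
Definition mx_signature (R : realType) (m : nat) (G : 'M[R]_m) (p q : nat) :
    Prop :=
  (p + q = m)%N /\
  exists2 P : 'M[R]_m, P \in unitmx &
    P *m G *m P^T = diag_mx (\row_(i < m) (if (i < p)%N then 1 else -1)).

Definition lat_signature (R : realType) (X : preLattice) (p q : nat) : Prop :=
  exists (r : nat) (b : 'I_r -> X), zbasis b /\
    mx_signature (\matrix_(i, j) (pl_form (b i) (b j))%:~R : 'M[R]_r) p q.

Section Opposite.
Variable X : preLattice.

Let oform (x y : X) : int := - pl_form x y.

Let oformC x y : oform x y = oform y x.
Proof. by rewrite /oform pl_formC. Qed.

Let oformB x y z : oform (x - y) z = oform x z - oform y z.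
Proof. by rewrite /oform pl_formB opprD. Qed.

(* The lattice X(-1). *)
Definition lat_opp : preLattice := PreLattice oformC oformB.

End Opposite.

Section Dual.
Variable X : preLattice.

Definition dual_pred : {pred (X -> int)} := fun a => `[< zmod_morphism a >].

Lemma dual_pred_zmod : zmod_closed dual_pred.
Proof.
split; first by apply/asboolP => x y; rewrite subrr.
move=> a b /asboolP ha /asboolP hb; apply/asboolP => x y.
rewrite -[LHS]/(a (x - y) - b (x - y)) ha hb.
by rewrite -[RHS]/(a x - b x - (a y - b y)); ring.
Qed.

HB.instance Definition _ := GRing.isZmodClosed.Build (X -> int) dual_pred
  dual_pred_zmod.

(* The dual lattice X^* is taken to be Hom(X, Z); X maps to it by x |-> <x, .>,
   and the Q-valued form of X^* is recovered in [dual_square]. *)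
Definition dual : Type := {a : X -> int | a \in dual_pred}.

HB.instance Definition _ := Choice.on dual.
HB.instance Definition _ := SubType.on dual.
HB.instance Definition _ := [SubChoice_isSubZmodule of dual by <:].

Lemma to_dual_subproof (x : X) : pl_form x \in dual_pred.
Proof.
by apply/asboolP => y z; rewrite ![pl_form x _]pl_formC pl_formB.
Qed.

Definition to_dual (x : X) : dual := exist _ (pl_form x) (to_dual_subproof x).

Definition lat_in_dual : {pred dual} := fun a => `[< exists x, a = to_dual x >].

Lemma to_dualB (x y : X) : to_dual (x - y) = to_dual x - to_dual y.
Proof. by apply/val_inj/funext => z; rewrite /= pl_formB. Qed.

Lemma to_dual0 : to_dual 0 = 0.
Proof. by rewrite -(subrr 0) to_dualB subrr. Qed.

Lemma to_dualN (x : X) : to_dual (- x) = - to_dual x.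
Proof. by rewrite -[- x]sub0r to_dualB to_dual0 sub0r. Qed.

Lemma lat_in_dual_zmod : zmod_closed lat_in_dual.
Proof.
split; first by apply/asboolP; exists 0; rewrite to_dual0.
move=> a b /asboolP[x ->] /asboolP[y ->]; apply/asboolP.
by exists (x - y); rewrite to_dualB.
Qed.

HB.instance Definition _ := GRing.isZmodClosed.Build dual lat_in_dual
  lat_in_dual_zmod.

Definition disc : Type := Quotient.quot lat_in_dual.

HB.instance Definition _ := GRing.Zmodule.on disc.

(* The square of [a] for the Q-valued extension of the form to X^*: if
   m a = <x, .> with m <> 0, then <a, a> = <x, a> / m = a(x) / m. *)
Definition dual_square (a : dual) (r : rat) : Prop :=
  exists (m : int) (x : X),
    [/\ m != 0, forall y, m * val a y = pl_form x y
      & r = (val a x)%:Q / m%:Q].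

Definition dual_norm (a : dual) : rat := xget 0 (dual_square a).

Lemma dual_square_uniq (a : dual) (r s : rat) :
  dual_square a r -> dual_square a s -> r = s.
Proof.
case=> m [x [m0 hx ->]] [k [y [k0 hy ->]]].
have mQ : m%:Q != 0 by rewrite intr_eq0.
have kQ : k%:Q != 0 by rewrite intr_eq0.
apply/eqP; rewrite eqr_div // -!intrM eqr_int mulrC hy pl_formC -hx mulrC.
by [].
Qed.

Lemma dual_squareD (a : dual) (y : X) (r : rat) : dual_square a r ->
  dual_square (a + to_dual y) (r + (2 * val a y + pl_form y y)%:Q).
Proof.
have formMz (m : int) (u w : X) : pl_form (u *~ m) w = m * pl_form u w.
  by apply: (@zmod_morphismMz _ (pl_form^~ w)) => ? ?; rewrite /= pl_formB.
have aD (u v : X) : val a (u + v) = val a u + val a v.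
  have /asboolP h := valP a.
  have h0 : val a 0 = 0 by rewrite -(subrr (0 : X)) h subrr.
  by rewrite -{1}[v]opprK h -[- v]add0r h h0 sub0r opprK.
have aMz (m : int) (u : X) : val a (u *~ m) = m * val a u.
  by have /asboolP h := valP a; apply: zmod_morphismMz.
case=> m [x [m0 hx ->]]; exists m, (x + y *~ m); split=> //.
  by move=> z; rewrite /= mulrDr hx pl_formDl formMz.
have mQ : m%:Q != 0 by rewrite intr_eq0.
apply: (mulIf mQ); rewrite mulrDl !divfK // -intrM -intrD; congr (_%:~R).
rewrite -[val (a + to_dual y) _]/(val a (x + y *~ m) + pl_form y (x + y *~ m)).
rewrite aD aMz pl_formDr [pl_form y (_ *~ _)]pl_formC formMz.
rewrite [pl_form y x]pl_formC -hx; ring.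
Qed.

Lemma dual_normD (a : dual) (y : X) : exists k : int,
  dual_norm (a + to_dual y) = dual_norm a + (2 * k + pl_form y y)%:Q \/
  dual_norm (a + to_dual y) = dual_norm a.
Proof.
rewrite /dual_norm; case: (pselect (exists r, dual_square a r)) => [[r hr]|h].
  exists (val a y); left; rewrite (xget_subset1 _ hr); last first.
    by move=> s t; apply: dual_square_uniq.
  rewrite (xget_subset1 _ (dual_squareD y hr)) //.
  by move=> s t; apply: dual_square_uniq.
exists 0; right; rewrite !xgetPN // => r hr; apply: h; first by exists r.
have := dual_squareD (- y) hr.
have -> : a + to_dual y + to_dual (- y) = a by rewrite to_dualN addrK.
by exists (r + (2 * val (a + to_dual y) (- y) + pl_form (- y) (- y))%:Q).
Qed.

End Dual.

Arguments to_dual {X} x.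
Arguments lat_in_dual X : clear implicits.

Definition two_Z : {pred rat} := fun r => r / 2 \is a Num.int.

Lemma two_Z_zmod : zmod_closed two_Z.
Proof.
split; first by rewrite unfold_in mul0r rpred0.
by move=> r s; rewrite !unfold_in mulrBl; apply: rpredB.
Qed.

HB.instance Definition _ := GRing.isZmodClosed.Build rat two_Z two_Z_zmod.

Definition Q2Z : Type := Quotient.quot two_Z.

HB.instance Definition _ := GRing.Zmodule.on Q2Z.
HB.instance Definition _ := EqQuotient.on Q2Z.

Definition disc_pi (X : preLattice) (a : dual X) : disc X :=
  \pi_(Quotient.quot (lat_in_dual X)) a.

Definition disc_repr (X : preLattice) (a : disc X) : dual X :=
  repr (a : Quotient.quot (lat_in_dual X)).

Lemma disc_piP (X : preLattice) (a b : dual X) :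
  disc_pi a = disc_pi b <-> exists x, a = b + to_dual x.
Proof.
rewrite /disc_pi; split=> [/eqP|[x ->]].
  rewrite -Quotient.idealrBE => /asboolP[x hx]; exists x.
  by rewrite -hx addrC subrK.
apply/eqP; rewrite -Quotient.idealrBE; apply/asboolP; exists x.
by rewrite addrC addKr.
Qed.

Lemma disc_reprK (X : preLattice) : cancel (@disc_repr X) (@disc_pi X).
Proof. by move=> a; rewrite /disc_pi /disc_repr reprK. Qed.

Lemma disc_piB (X : preLattice) : zmod_morphism (@disc_pi X).
Proof. by move=> a b; rewrite /disc_pi raddfB. Qed.

(* For an even lattice, the class mod 2Z does not depend on the representative
   ([disc_qE]). *)
Definition disc_q (X : preLattice) (a : disc X) : Q2Z :=
  \pi_Q2Z (dual_norm (disc_repr a)).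

Lemma disc_qE (X : preLattice) (a : dual X) :
  even_lattice X -> disc_q (disc_pi a) = \pi_Q2Z (dual_norm a).
Proof.
case=> _ evX _.
have [x hx] : exists x, disc_repr (disc_pi a) = a + to_dual x.
  by apply/disc_piP; rewrite disc_reprK.
rewrite /disc_q hx; have [k [->|-> //]] := dual_normD a x.
apply/eqP; rewrite -Quotient.idealrBE unfold_in addrC addKr.
have /dvdzP[m ->] := evX x.
by rewrite [m * 2]mulrC -mulrDr intrM mulrC mulKf // intr_int.
Qed.

Record disc_iso (X Y : preLattice) : Type := DiscIso {
  di_fun :> disc X -> disc Y;
  di_inv : disc Y -> disc X;
  di_funK : cancel di_fun di_inv;
  di_invK : cancel di_inv di_fun;
  di_add : zmod_morphism di_fun;
  di_q : forall a, disc_q (di_fun a) = disc_q a }.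

Section DiscIsoInv.
Variables (X Y : preLattice) (phi : disc_iso X Y).

Lemma disc_iso_inv_add : zmod_morphism (di_inv phi).
Proof.
move=> a b; apply: (can_inj (di_funK phi)).
by rewrite di_add !di_invK.
Qed.

Lemma disc_iso_inv_q a : disc_q (di_inv phi a) = disc_q a.
Proof. by rewrite -{2}[a](di_invK phi) di_q. Qed.

Definition disc_iso_inv : disc_iso Y X :=
  DiscIso (di_invK phi) (di_funK phi) disc_iso_inv_add disc_iso_inv_q.

End DiscIsoInv.

Record lat_iso (X Y : preLattice) : Type := LatIso {
  li_fun :> X -> Y;
  li_inv : Y -> X;
  li_funK : cancel li_fun li_inv;
  li_invK : cancel li_inv li_fun;
  li_add : zmod_morphism li_fun;
  li_form : forall x y, pl_form (li_fun x) (li_fun y) = pl_form x y }.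

Section Induced.
Variables (X Y : evenLattice) (f : lat_iso X Y).

Lemma dual_push_subproof (a : dual X) :
  (fun y => val a (li_inv f y)) \in @dual_pred Y.
Proof.
have /asboolP ha := valP a; apply/asboolP => y z.
rewrite -ha; congr (val a _); apply: (can_inj (li_funK f)).
by rewrite li_add !li_invK.
Qed.

Definition dual_push (a : dual X) : dual Y :=
  exist _ (fun y => val a (li_inv f y)) (dual_push_subproof a).

Lemma dual_push_add : zmod_morphism dual_push.
Proof. by move=> a b; apply/val_inj/funext. Qed.

Lemma dual_push_to_dual (x : X) : dual_push (to_dual x) = to_dual (f x).
Proof.
by apply/val_inj/funext => y; rewrite /= -(li_form f) li_invK.
Qed.

Lemma dual_square_push (a : dual X) (r : rat) :
  dual_square (dual_push a) r <-> dual_square a r.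
Proof.
split=> -[m [x [m0 hx ->]]].
  exists m, (li_inv f x); split=> // y; have := hx (f y).
  by rewrite /= li_funK => ->; rewrite -(li_form f) li_invK.
exists m, (f x); split=> //= [y|]; last by rewrite li_funK.
by rewrite hx -(li_form f) li_invK.
Qed.

Lemma dual_norm_push (a : dual X) : dual_norm (dual_push a) = dual_norm a.
Proof.
rewrite /dual_norm; congr xget; apply/funext => r; apply/propext.
exact: dual_square_push.
Qed.

(* Independent of the representative, by [disc_pushE]. *)
Definition disc_push (a : disc X) : disc Y := disc_pi (dual_push (disc_repr a)).

Lemma disc_pushE (a : dual X) : disc_push (disc_pi a) = disc_pi (dual_push a).
Proof.
have [x hx] : exists x, disc_repr (disc_pi a) = a + to_dual x.
  by apply/disc_piP; rewrite disc_reprK.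
apply/disc_piP; exists (f x); rewrite hx -dual_push_to_dual.
by apply/val_inj/funext.
Qed.

Lemma disc_push_add : zmod_morphism disc_push.
Proof.
move=> a b; rewrite -[a]disc_reprK -[b]disc_reprK -disc_piB !disc_pushE.
by rewrite dual_push_add disc_piB.
Qed.

Lemma disc_push_q a : disc_q (disc_push a) = disc_q a.
Proof.
rewrite -[a]disc_reprK disc_pushE !disc_qE ?dual_norm_push //.
  exact: el_even X.
exact: el_even Y.
Qed.

End Induced.

Section LatIsoTheory.
Variables (X Y Z : preLattice).

Definition lat_iso_id : lat_iso X X :=
  @LatIso X X id id (fun=> erefl) (fun=> erefl) (fun _ _ => erefl)
    (fun _ _ => erefl).

Lemma lat_iso_inv_add (f : lat_iso X Y) : zmod_morphism (li_inv f).
Proof. by move=> x y; apply: (can_inj (li_funK f)); rewrite li_add !li_invK. Qed.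

Lemma lat_iso_inv_form (f : lat_iso X Y) x y :
  pl_form (li_inv f x) (li_inv f y) = pl_form x y.
Proof. by rewrite -(li_form f) !li_invK. Qed.

Definition lat_iso_inv (f : lat_iso X Y) : lat_iso Y X :=
  LatIso (li_invK f) (li_funK f) (lat_iso_inv_add f) (lat_iso_inv_form f).

Lemma lat_iso_comp_add (g : lat_iso Y Z) (f : lat_iso X Y) :
  zmod_morphism (g \o f).
Proof. by move=> x y; rewrite /= !li_add. Qed.

Lemma lat_iso_comp_form (g : lat_iso Y Z) (f : lat_iso X Y) x y :
  pl_form ((g \o f) x) ((g \o f) y) = pl_form x y.
Proof. by rewrite /= !li_form. Qed.

Definition lat_iso_comp (g : lat_iso Y Z) (f : lat_iso X Y) : lat_iso X Z :=
  LatIso (can_comp (li_funK g) (li_funK f)) (can_comp (li_invK f) (li_invK g))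
    (lat_iso_comp_add g f) (lat_iso_comp_form g f).

End LatIsoTheory.

Lemma disc_push_inv (X Y : evenLattice) (f : lat_iso X Y) :
  cancel (disc_push f) (disc_push (lat_iso_inv f : lat_iso Y X)).
Proof.
move=> a; rewrite -[a]disc_reprK !disc_pushE; congr disc_pi.
by apply/val_inj/funext => y; rewrite /= li_funK.
Qed.

Lemma disc_push_invr (X Y : evenLattice) (f : lat_iso X Y) :
  cancel (disc_push (lat_iso_inv f : lat_iso Y X)) (disc_push f).
Proof.
move=> a; rewrite -[a]disc_reprK !disc_pushE; congr disc_pi.
by apply/val_inj/funext => y; rewrite /= li_invK.
Qed.

(* The isometry f^* : A_X -> A_Y, covariant in [f]: on X^* = Hom(X, Z) it is
   precomposition with f^-1, which extends [f] itself. *)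
Definition disc_of (X Y : evenLattice) (f : lat_iso X Y) : disc_iso X Y :=
  DiscIso (disc_push_inv f) (disc_push_invr f) (disc_push_add f) (disc_push_q f).

Lemma disc_of_id (X : evenLattice) : disc_of (lat_iso_id X : lat_iso X X) =1 id.
Proof.
move=> a; rewrite -[a]disc_reprK /= disc_pushE; congr disc_pi.
exact/val_inj/funext.
Qed.

Lemma disc_of_comp (X Y Z : evenLattice) (g : lat_iso Y Z) (f : lat_iso X Y) :
  disc_of (lat_iso_comp g f : lat_iso X Z) =1 disc_of g \o disc_of f.
Proof.
move=> a; rewrite -[a]disc_reprK /= !disc_pushE; congr disc_pi.
exact/val_inj/funext.
Qed.

Section Triples.
Variables (R : realType) (n : nat).

Definition same_signature (X Y : preLattice) : Prop :=
  exists p q, lat_signature R X p q /\ lat_signature R Y p q.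

Definition triple_axioms (X Y : evenLattice) : Prop :=
  [/\ lat_rank X n, lat_rank Y n & same_signature X Y].

Record triple : Type := Triple {
  tX : evenLattice;
  tY : evenLattice;
  tP : triple_axioms tX tY;
  tphi : disc_iso tY tX }.

Definition properly_equivalent (T T' : triple) : Prop :=
  exists (f : lat_iso (tX T) (tX T')) (g : lat_iso (tY T) (tY T')),
    tphi T' =1 disc_of f \o tphi T \o di_inv (disc_of g).

Lemma properly_equivalentP (T T' : triple) : properly_equivalent T T' <->
  exists (f : lat_iso (tX T) (tX T')) (g : lat_iso (tY T) (tY T')),
    forall a, tphi T' (disc_of g a) = disc_of f (tphi T a).
Proof.
split=> -[f [g h]]; exists f, g => a.
  by rewrite h /= disc_push_inv.
by rewrite -{1}[a](di_invK (disc_of g)) h.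
Qed.

Lemma properly_equivalent_equiv : is_equiv properly_equivalent.
Proof.
split.
- move=> T; apply/properly_equivalentP.
  by exists (lat_iso_id _), (lat_iso_id _) => a; rewrite !disc_of_id.
- move=> T T' /properly_equivalentP[f [g h]]; apply/properly_equivalentP.
  exists (lat_iso_inv f), (lat_iso_inv g) => a.
  rewrite -[a](di_invK (disc_of g)) h.
  by rewrite [LHS]/= [RHS]/= !disc_push_inv.
- move=> T1 T2 T3 /properly_equivalentP[f [g h]] /properly_equivalentP[f' [g' h']].
  apply/properly_equivalentP.
  exists (lat_iso_comp f' f), (lat_iso_comp g' g) => a.
  by rewrite !disc_of_comp /= -[disc_push g _]/(disc_of g _) h' h.
Qed.

Lemma triple_sigma_subproof (X Y : evenLattice) :
  triple_axioms X Y -> triple_axioms Y X.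
Proof. by case=> rX rY [p [q [sX sY]]]; split=> //; exists p, q. Qed.

Definition triple_sigma (T : triple) : triple :=
  Triple (triple_sigma_subproof (tP T)) (disc_iso_inv (tphi T)).

Lemma triple_sigma_equiv (T T' : triple) : properly_equivalent T T' ->
  properly_equivalent (triple_sigma T) (triple_sigma T').
Proof.
move=> /properly_equivalentP[f [g h]]; apply/properly_equivalentP.
exists g, f => a; apply: (can_inj (di_funK (tphi T'))).
by rewrite h /= !di_invK.
Qed.

Definition Tbar : Type := quotient properly_equivalent.

Definition Tclass : triple -> Tbar := cls properly_equivalent.

Definition Tbar_sigma : Tbar -> Tbar :=
  quotient_map properly_equivalent_equiv triple_sigma_equiv.

End Triples.

Section Narain.
Variables (R : realType) (n : nat).

Local Notation E := 'rV[R]_(n + n).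

Definition nform (x y : E) : R :=
  \sum_(i < n) x 0 (lshift n i) * y 0 (lshift n i) -
  \sum_(i < n) x 0 (rshift n i) * y 0 (rshift n i).

Lemma nformC x y : nform x y = nform y x.
Proof.
by congr (_ - _); apply: eq_bigr => i _; rewrite mulrC.
Qed.

Lemma nform_linear x : linear (nform x : E -> R^o).
Proof.
move=> a y z; rewrite /nform scalerBr addrACA -opprD.
congr (_ - _); rewrite scaler_sumr -big_split; apply: eq_bigr => i _;
  by rewrite !mxE mulrDr mulrCA.
Qed.

Lemma nform_bilinear : bilinear_for (GRing.Scale.Law.clone _ _ ( *%R ) _)
  (GRing.Scale.Law.clone _ _ (@idfun R \; *%R ) _) nform.
Proof.
split=> x a y z; last exact: nform_linear.
by rewrite ![nform _ x]nformC; apply: nform_linear.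
Qed.

HB.instance Definition _ := bilinear_isBilinear.Build R _ _ _
  (GRing.Scale.Law.clone _ _ ( *%R ) _)
  (GRing.Scale.Law.clone _ _ (@idfun R \; *%R ) _) nform nform_bilinear.

Lemma nform_hermitian x y : nform x y = (-1) ^+ false * idfun (nform y x).
Proof. by rewrite expr0 mul1r nformC. Qed.

HB.instance Definition _ := @isHermitianSesquilinear.Build R E false idfun
  nform nform_hermitian.

Definition perp (V : {vspace E}) : {vspace E} := orthov nform V.

Definition subspace_signature (V : {vspace E}) (p q : nat) : Prop :=
  mx_signature
    (\matrix_(i < \dim V, j < \dim V) nform (vbasis V)`_i (vbasis V)`_j) p q.

Record intSubgroup : Type := IntSubgroup {
  int_sub :> zmodClosed E;
  int_subP : {in int_sub &, forall x y, nform x y \is a Num.int} }.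

Section SubgroupLattice.
Variable G : intSubgroup.

Definition subgroup_sort : Type := {x : E | x \in int_sub G}.

HB.instance Definition _ := Choice.on subgroup_sort.
HB.instance Definition _ := SubType.on subgroup_sort.
HB.instance Definition _ := [SubChoice_isSubZmodule of subgroup_sort by <:].

(* The form is integral on [G], so that [Num.floor] only changes its type from
   [R] to [int]. *)
Definition subgroup_form (x y : subgroup_sort) : int :=
  Num.floor (nform (val x) (val y)).

Lemma subgroup_formE x y : (subgroup_form x y)%:~R = nform (val x) (val y).
Proof. by apply/eqP; rewrite -intrEfloor; apply: int_subP; apply: valP. Qed.

Lemma subgroup_formC x y : subgroup_form x y = subgroup_form y x.
Proof. by rewrite /subgroup_form nformC. Qed.

Lemma subgroup_formB x y z :
  subgroup_form (x - y) z = subgroup_form x z - subgroup_form y z.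
Proof.
by apply: (@intr_inj R); rewrite rmorphB /= !subgroup_formE linearBl.
Qed.

Definition subgroup_lattice : preLattice :=
  PreLattice subgroup_formC subgroup_formB.

Definition inter_pred (U : {vspace E}) : {pred E} :=
  fun x => (x \in int_sub G) && (x \in U).

Lemma inter_pred_zmod U : zmod_closed (inter_pred U).
Proof.
split; first by rewrite unfold_in !rpred0.
move=> x y /andP[xG xU] /andP[yG yU].
by apply/andP; split; apply: rpredB.
Qed.

HB.instance Definition _ U := GRing.isZmodClosed.Build E (inter_pred U)
  (inter_pred_zmod U).

Lemma inter_pred_int U :
  {in inter_pred U &, forall x y, nform x y \is a Num.int}.
Proof. by move=> x y /andP[xG _] /andP[yG _]; exact: (int_subP xG yG). Qed.

Definition inter (U : {vspace E}) : intSubgroup := IntSubgroup (@inter_pred_int U).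

End SubgroupLattice.

Definition unimodular (X : preLattice) : Prop :=
  forall a : dual X, exists x, a = to_dual x.

Definition narain (G : intSubgroup) : Prop :=
  [/\ even_lattice (subgroup_lattice G), unimodular (subgroup_lattice G)
    & lat_signature R (subgroup_lattice G) n n].

Section Fixed.
Variable V : {vspace E}.

Definition Gamma_L (G : intSubgroup) : preLattice :=
  subgroup_lattice (inter G V).

Definition Gamma_R (G : intSubgroup) : preLattice :=
  subgroup_lattice (inter G (perp V)).

Record ratNarain : Type := RatNarain {
  rn_sub :> intSubgroup;
  rn_narain : narain rn_sub;
  rn_rational : lat_rank (Gamma_L rn_sub) (\dim V) }.

(* g lies in O(V) x O(V^perp), seen in O(R^{n,n}). *)
Definition in_OVxOVperp (g : 'End(E)) : Prop :=
  [/\ forall x y, nform (g x) (g y) = nform x y,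
      (g @: V = V)%VS & (g @: perp V = perp V)%VS].

Definition V_equivalent (G G' : ratNarain) : Prop :=
  exists2 g : 'End(E), in_OVxOVperp g &
    forall z, z \in int_sub G' <-> exists2 x, x \in int_sub G & z = g x.

Definition Rbar : Type := quotient V_equivalent.

Definition Rclass : ratNarain -> Rbar := cls V_equivalent.

(* The condition
     Gamma / (Gamma_L + Gamma_R) = {phi(a) + a | a in Gamma_R(-1)^*/Gamma_R(-1)},
   for the preimages in Gamma_L^* + Gamma_R^*, a subset of V + V^perp.  The
   vector v is the element of Gamma_L^* given by the functional <v, .>; the
   vector w is the element of Gamma_R(-1)^* given by -<w, .>, since the form
   of Gamma_R(-1) is -<., .>. *)
Definition gluing (G : ratNarain)
    (phi : disc_iso (lat_opp (Gamma_R G)) (Gamma_L G)) : Prop :=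
  forall v w, v \in V -> w \in perp V ->
    v + w \in int_sub G <->
    exists (b : dual (Gamma_L G)) (a : dual (lat_opp (Gamma_R G))),
      [/\ forall x : Gamma_L G, (val b x)%:~R = nform v (val x),
          forall y : Gamma_R G, (val a y)%:~R = - nform w (val y)
        & phi (disc_pi a) = disc_pi b].

Definition is_gamma (G : ratNarain) (T : triple R n) : Prop :=
  exists (hL : even_lattice (Gamma_L G))
         (hR : even_lattice (lat_opp (Gamma_R G)))
         (h : triple_axioms R n (EvenLattice hL) (EvenLattice hR))
         (phi : disc_iso (lat_opp (Gamma_R G)) (Gamma_L G)),
    gluing phi /\ T = @Triple R n (EvenLattice hL) (EvenLattice hR) h phi.

Definition same_signature_as_V (X : preLattice) : Prop :=
  exists p q, lat_signature R X p q /\ subspace_signature V p q.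

Definition anti_isometry (s : 'Hom(subvs_of V, subvs_of (perp V))) : Prop :=
  bijective s /\
  forall x y, nform (vsval (s x)) (vsval (s y)) = - nform (vsval x) (vsval y).

(* The extension (x, y) |-> (s^-1 y, s x) to R^{n,n} = V + V^perp. *)
Definition sigma_ext (s : 'Hom(subvs_of V, subvs_of (perp V))) (z : E) : E :=
  vsval ((s^-1)%VF (vsproj (perp V) (daddv_pi (perp V) V z))) +
  vsval (s (vsproj V (daddv_pi V (perp V) z))).

End Fixed.

End Narain.

Arguments Tclass {R n} T.
Arguments Tbar_sigma {R n} _.
Arguments Rclass {R n V} G : rename.

(* Main.v *)
Require Import Defs.
From HB Require Import structures.
From mathcomp Require Import all_boot all_order all_algebra.
From mathcomp Require Import boolp classical_sets functions reals.
From mathcomp Require Import ring lra zify sesquilinear.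

(** A Narain lattice G is recovered from G_L, G_R and the set of pairs (v, w) in
    V + V^perp with v + w in G. Since G is unimodular and its two components
    are primitive of full rank, every functional on G_R is the pairing with some
    element of G ([complement_dual]), and likewise for G_L; so each class of
    A_{G_R(-1)} is matched with exactly one class of A_{G_L}, and evenness
    of v + w makes the matching an isometry phi ([exists_gluing]).
    Conversely, lattices X in V and Y(-1) in V^perp and an isometry phi from
    A_Y to A_X determine the set of those v + w whose classes correspond
    under phi. This set is an even lattice, and a vector that pairs
    integrally with it belongs to it ([glue_set_dual]), so it is a V-rational
    Narain lattice ([glue_exists]).

    Everything is phrased through embeddings of abstract lattices in real
    subspaces: an element v of a subspace represents a functional a
    on X when a is the pairing with v, and [glued phi v w] says that v and w
    represent functionals whose classes correspond under phi. An embedding of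
    Y(-1) is treated as an embedding of Y that multiplies the form by -1. Three
    facts then give the theorem.

    - Gluing is natural under isometries of the lattices that come from linear
      maps of R^{n,n} multiplying the form by a sign ([glued_push]), and a linear
      map that sends glued pairs to glued pairs intertwines the isometries of
      discriminant groups ([push_of_glued]). Therefore, if G is the glue of an
      embedded triple T, the triple of G is properly equivalent to T
      ([gamma_of_glued]). Applied to an element of O(V) x O(V^perp) this shows
      that the triple depends only on the V-equivalence class; applied to the
      anti-isometry sigma, which exchanges V and V^perp, it shows that the
      triple of sigma G is the triple of G with its two lattices exchanged.
    - Two isometries G_L -> G'_L and G_R -> G'_R extend linearly to an element of
      O(V) x O(V^perp) ([exists_extension]); if they intertwine the two gluing
      isometries, this element carries G to G', again by [glued_push]. This is
      injectivity.
    - A lattice of the signature of V embeds isometrically in V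
      ([embeds_of_signature]), so every triple of that signature is glued from
      an embedding of X in V and, through sigma, of Y(-1) in V^perp. Conversely
      the signature of G_L is that of V because G_L spans V.

    Injectivity on the orbits of sigma is then formal: an injective map that
    commutes with two involutions is injective on orbits ([orbit_lift]). *)

Set Implicit Arguments.
Unset Strict Implicit.
Unset Printing Implicit Defensive.

Import Order.TTheory GRing.Theory Num.Theory.

Local Open Scope ring_scope.

Local Notation rmx := (map_mx (intmul 1)).

(** * Subgroups of Z^m *)

Section IntegerMatrices.
Variable R : realType.

Lemma rmx_inj m p : injective (rmx : 'M[int]_(m, p) -> 'M[R]_(m, p)).
Proof.
move=> A B /matrixP h; apply/matrixP => i j.
by have := h i j; rewrite !mxE => /intr_inj.
Qed.

(** Induction on m: a generator of the ideal of first coordinates of H lifts to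
    an element h of H, and h completes a basis of the elements of H with first
    coordinate 0. The basis is in echelon form, hence independent over R and not
    only over Z. *)
Lemma subgroup_basis m (H : 'rV[int]_m -> Prop) :
  H 0 -> (forall x y, H x -> H y -> H (x - y)) ->
  exists r (B : 'M[int]_(r, m)),
    [/\ (r <= m)%N, forall c, H (c *m B), forall x, H x -> exists c, x = c *m B
      & row_free (rmx B : 'M[R]_(r, m))].
Proof.
elim: m H => [|m IHm] H H0 HB.
  exists 0, 0; split=> //.
  - by move=> c; rewrite mulmx0.
  - by move=> x _; exists 0; apply/rowP; case.
  - by rewrite -row_leq_rank.
move: H H0 HB; rewrite -[m.+1]/(1 + m)%N => H H0 HB.
pose o : 'I_(1 + m) := lshift m ord0.
pose ld (x : 'rV[int]_(1 + m)) : int := x 0 o.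
have ldB x k y : ld (x - k *: y) = ld x - k * ld y by rewrite /ld !mxE.
have HN x : H x -> H (- x) by move=> hx; rewrite -sub0r; apply: HB.
have HD x y : H x -> H y -> H (x + y).
  by move=> hx /HN hy; rewrite -[y]opprK; apply: HB.
have HZ (k : int) x : H x -> H (k *: x).
  move=> hx; have nat_case (j : nat) : H (j%:Z *: x).
    elim: j => [|j IHj]; first by rewrite scale0r.
    by rewrite intS scalerDl scale1r; apply: HD.
  by case: k => j //; rewrite NegzE scaleNr; apply/HN/nat_case.
pose pad (y : 'rV[int]_m) : 'rV[int]_(1 + m) := row_mx 0 y.
have padB y z : pad (y - z) = pad y - pad z.
  by rewrite /pad opp_row_mx add_row_mx subr0.
have pad_tl (x : 'rV_(1 + m)) : ld x = 0 -> x = pad (rsubmx x).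
  move=> x0; rewrite -[LHS]hsubmxK /pad; congr row_mx.
  by apply/rowP => j; rewrite !mxE ord1.
have padM k (c : 'rV_k) (A : 'M_(k, m)) :
    pad (c *m A) = c *m row_mx (0 : 'M_(k, 1)) A.
  by rewrite /pad mul_mx_row mulmx0.
have [||r [B [rm HBm HBc Bfree]]] := IHm (fun y => H (pad y)).
- by rewrite /pad row_mx0.
- by move=> y z hy hz; rewrite padB; apply: HB.
have rmx0 k : rmx (0 : 'M_(k, 1)) = 0 :> 'M[R]_(k, 1).
  by apply/matrixP => ? ?; rewrite !mxE.
have [H00|] := pselect (forall x : 'rV_(1 + m), H x -> ld x = 0).
  exists r, (row_mx 0 B); split=> //; first exact: leqW.
  - by move=> c; rewrite -padM; apply: HBm.
  - move=> x hx; have ex := pad_tl x (H00 _ hx); rewrite ex in hx.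
    by have [c hc] := HBc _ hx; exists c; rewrite ex hc padM.
  - rewrite map_row_mx rmx0; apply/row_freeP.
    have /row_freeP[D BD] := Bfree; exists (col_mx 0 D).
    by rewrite mul_row_col mulmx0 add0r.
(* The first coordinates of H form an ideal of Z: take h with the least
   positive first coordinate. *)
move=> /existsNP[x1 /not_implyP[hx1 x10]].
pose P (d : nat) := `[< exists2 x : 'rV_(1 + m), H x & ld x = d.+1%:Z >].
have exP : exists d, P d.
  exists (absz (ld x1)).-1; apply/asboolP.
  have -> : (absz (ld x1)).-1.+1%:Z = absz (ld x1) by lia.
  rewrite abszE; have [_|_] := ger0P (ld x1); first by exists x1.
  by exists (- x1); [apply: HN | rewrite /ld mxE].
case: (ex_minnP exP) => d /asboolP[h Hh h0] dmin {exP}.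
have dvd_h (x : 'rV_(1 + m)) : H x -> (ld x = (ld x %/ ld h)%Z * ld h).
  move=> hx; apply/esym/eqP; rewrite -dvdz_eq; apply/dvdz_mod0P.
  apply: contrapT => /eqP ne0.
  have h00 : ld h != 0 by rewrite h0.
  have := modz_ge0 (ld x) h00.
  have := ltz_pmod (ld x) (_ : 0 < ld h).
  rewrite h0 in ne0 *; move=> /(_ isT) lt_d ge0.
  have /dmin : P (absz (ld x %% d.+1)%Z).-1; last by lia.
  apply/asboolP; exists (x - (ld x %/ ld h)%Z *: h); first by apply/HB/HZ.
  rewrite ldB h0 {1}[ld x](divz_eq _ d.+1) addrC addKr.
  by lia.
exists (1 + r)%N, (col_mx h (row_mx 0 B)); split=> //.
- move=> c; rewrite -[c]hsubmxK mul_row_col.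
  apply: HD; last by rewrite -padM; apply: HBm.
  by rewrite [lsubmx _]mx11_scalar mul_scalar_mx; apply: HZ.
- move=> x hx; pose k := (ld x %/ ld h)%Z.
  have Hy : H (x - k *: h) by apply/HB/HZ.
  have y0 : ld (x - k *: h) = 0 by rewrite ldB -dvd_h ?subrr.
  have ey := pad_tl _ y0; rewrite ey in Hy; have [c hc] := HBc _ Hy.
  exists (row_mx k%:M c); rewrite mul_row_col.
  by rewrite mul_scalar_mx -padM -hc -ey addrC subrK.
- rewrite -kermx_eq0; apply/eqP/row_matrixP => i; rewrite row0.
  set u := row i _.
  have : u *m rmx (col_mx h (row_mx 0 B)) = 0 by rewrite -row_mul mulmx_ker row0.
  rewrite -[u]hsubmxK map_col_mx mul_row_col.
  rewrite [lsubmx _]mx11_scalar mul_scalar_mx; set a := _ 0 0; set v := rsubmx _.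
  rewrite map_row_mx mul_mx_row rmx0 mulmx0 => uB.
  have a0 : a = 0.
    have /rowP/(_ o) := uB; rewrite mxE [X in X + _]mxE row_mxEl.
    rewrite [rmx h _ _]mxE -/(ld h) h0 !mxE addr0 => /eqP.
    by rewrite mulf_eq0 intr_eq0 /= orbF => /eqP.
  have v0 : v = 0.
    apply: (row_free_inj Bfree); rewrite mul0mx.
    by move: uB; rewrite a0 scale0r add0r => /(congr1 rsubmx); rewrite row_mxKr linear0.
  by rewrite v0 a0 raddf0 row_mx0.
Qed.

End IntegerMatrices.

(** * Signatures of real symmetric matrices *)

Section Sylvester.
Variable R : realType.

Lemma mx_signature_congr m m' (G : 'M[R]_m) (G' : 'M[R]_m') (P : 'M_(m', m))
    p q :
  m = m' -> row_free P -> G' = P *m G *m P^T ->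
  mx_signature G' p q <-> mx_signature G p q.
Proof.
move=> e; subst m'; rewrite row_free_unit => Pu ->; split=> -[epq [Q Qu hQ]].
  split=> //; exists (Q *m P); first by rewrite unitmx_mul Qu.
  by rewrite -hQ trmx_mul !mulmxA.
split=> //; exists (Q *m invmx P); first by rewrite unitmx_mul Qu unitmx_inv.
rewrite -hQ trmx_mul !mulmxA mulmxKV // -[_ *m P^T *m _]mulmxA -trmx_mul.
by rewrite mulVmx // trmx1 mulmx1.
Qed.

Definition unit_block m (Q : 'M[R]_m) : 'M[R]_(1 + m) := block_mx 1%:M 0 0 Q.

Lemma unit_block_unit m (Q : 'M[R]_m) : Q \in unitmx -> unit_block Q \in unitmx.
Proof. by move=> Qu; rewrite unitmxE det_ublock det1 mul1r -unitmxE. Qed.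

(** The orthogonal of a non-isotropic vector is a complement of it; here it is the
    kernel of the pairing with u, of rank m. *)
Lemma split_vector m (G : 'M[R]_(1 + m)) (u : 'rV_(1 + m)) (e : R) :
  G^T = G -> G \in unitmx -> e != 0 -> u *m G *m u^T = e%:M ->
  exists P (G' : 'M[R]_m), [/\ P \in unitmx, G'^T = G', G' \in unitmx &
    P *m G *m P^T = block_mx e%:M 0 0 G'].
Proof.
move=> Gs Gu e0 hu; pose K := kermx (G *m u^T).
have rK : \rank K = m.
  rewrite mxrank_ker (_ : \rank _ = 1%N) ?subSS ?subn0 //.
  apply/eqP; rewrite eqn_leq rank_leq_col lt0n mxrank_eq0.
  apply: contra_neq e0 => h0.
  by move: hu; rewrite -mulmxA h0 mulmx0 => /matrixP/(_ 0 0); rewrite !mxE eqxx.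
have := row_base_free K; have : row_base K *m (G *m u^T) = 0.
  by apply/eqP; rewrite -sub_kermx eq_row_base.
move: (row_base K); rewrite rK => B BG Bfree.
pose P := col_mx u B.
have Pu : P \in unitmx.
  rewrite -row_free_unit -kermx_eq0; apply/eqP/row_matrixP => i; rewrite row0.
  set v := row i _; have : v *m P = 0 by rewrite /v -row_mul mulmx_ker row0.
  rewrite -[v]hsubmxK mul_row_col => vP.
  have v10 : lsubmx v = 0.
    have := congr1 (mulmx^~ (G *m u^T)) vP.
    rewrite mul0mx mulmxDl -[rsubmx v *m B *m _]mulmxA BG mulmx0 addr0.
    rewrite -mulmxA [u *m _]mulmxA hu mul_mx_scalar => /eqP.
    by rewrite scaler_eq0 (negPf e0) => /eqP.
  rewrite v10; move: vP; rewrite v10 mul0mx add0r => vP.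
  suff -> : rsubmx v = 0 by rewrite row_mx0.
  by apply: (row_free_inj Bfree); rewrite vP mul0mx.
have PGP : P *m G *m P^T = block_mx e%:M 0 0 (B *m G *m B^T).
  rewrite tr_col_mx mul_col_mx mul_col_row hu -[B *m G *m u^T]mulmxA BG.
  congr block_mx; apply/trmx_inj.
  by rewrite !trmx_mul !trmxK Gs trmx0.
exists P, (B *m G *m B^T); split=> //.
- by rewrite !trmx_mul trmxK Gs mulmxA.
- have : P *m G *m P^T \in unitmx by rewrite !unitmx_mul unitmx_tr Gu Pu.
  by rewrite PGP !unitmxE det_ublock unitrM => /andP[].
Qed.

Lemma unit_block_signature m (G : 'M[R]_(1 + m)) (G' : 'M[R]_m) P (e : R) p q :
  P \in unitmx -> P *m G *m P^T = block_mx e%:M 0 0 G' -> mx_signature G' p q ->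
  exists2 Q, Q \in unitmx & Q *m G *m Q^T =
    block_mx e%:M 0 0 (diag_mx (\row_(i < m) (if (i < p)%N then 1 else -1))).
Proof.
move=> Pu PG [_ [Q Qu QG]]; exists (unit_block Q *m P).
  by rewrite unitmx_mul unit_block_unit.
set U := unit_block Q.
have -> : U *m P *m G *m (U *m P)^T = U *m (P *m G *m P^T) *m U^T.
  by rewrite trmx_mul !mulmxA.
rewrite PG /U /unit_block tr_block_mx !mulmx_block.
by rewrite !(mul0mx, mulmx0, addr0, add0r, mulmx1, mul1mx, trmx0, trmx1) QG.
Qed.

Lemma block_sign_mx m (e : R) p p' :
  e = (if (0 < p')%N then 1 else -1) -> (forall i, (1 + i < p')%N = (i < p)%N) ->
  block_mx (e%:M : 'M_1) 0 0 (diag_mx (\row_(i < m) (if (i < p)%N then 1 else -1))) =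
  diag_mx (\row_(i < 1 + m) (if (i < p')%N then 1 else -1)).
Proof.
move=> -> hp; apply/matrixP => i j.
case: (split_ordP i) => k -> ; case: (split_ordP j) => l ->.
- by rewrite block_mxEul !mxE !ord1 !eqxx.
- by rewrite block_mxEur !mxE eq_lrshift.
- by rewrite block_mxEdl !mxE eq_rlshift.
- by rewrite block_mxEdr !mxE eq_rshift /= hp.
Qed.

(** Split off a vector of square 1 as long as there is one, so that the signs +1
    come first. When no square is positive, a vector of square -1 exists by
    polarization, and none of the remaining signs can be +1. *)
Lemma sylvester m (G : 'M[R]_m) :
  G^T = G -> G \in unitmx -> exists p q, mx_signature G p q.
Proof.
elim: m G => [|m IHm] G Gs Gu.
  exists 0%N, 0%N; split=> //; exists 1%:M; rewrite ?unitmx1 //.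
  by apply/matrixP; case.
move: G Gs Gu; rewrite -[m.+1]/(1 + m)%N => G Gs Gu.
pose Q (u : 'rV_(1 + m)) := (u *m G *m u^T) 0 0.
have QZ a u : Q (a *: u) = a ^+ 2 * Q u.
  by rewrite /Q linearZ /= -!scalemxAl -scalemxAr !mxE mulrA expr2.
have norm1 u : Q u != 0 -> exists v : 'rV_(1 + m), v *m G *m v^T = (Num.sg (Q u))%:M.
  move=> Q0; exists ((Num.sqrt `|Q u|)^-1 *: u).
  rewrite [LHS]mx11_scalar -[_ 0 0]/(Q _) QZ exprVn sqr_sqrtr //.
  congr (_%:M); rewrite {2}[Q u]numEsg mulrCA mulVf ?mulr1 //.
  by rewrite normr_eq0.
have [[u up]|npos] := pselect (exists u, 0 < Q u).
  have [v] := norm1 u (lt0r_neq0 up); rewrite gtr0_sg // => hv.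
  have [P [G' [Pu G's G'u PG]]] := split_vector Gs Gu (oner_neq0 _) hv.
  have [p [q sG]] := IHm _ G's G'u.
  have [P' P'u P'G] := unit_block_signature Pu PG sG.
  exists p.+1, q; split; first by rewrite addSn (proj1 sG).
  by exists P' => //; rewrite P'G; apply: block_sign_mx.
have [u u0] : exists u, Q u != 0.
  apply: contrapT => Q0.
  have {}Q0 u : Q u = 0 by apply: contrapT => /eqP h; apply: Q0; exists u.
  suff G0 : G = 0 by move: Gu; rewrite G0 unitmxE det0 unitr0.
  pose b (x y : 'rV_(1 + m)) := (x *m G *m y^T) 0 0.
  have bC x y : b x y = b y x.
    by rewrite /b -[in LHS](trmxK (x *m G *m y^T)) mxE !trmx_mul trmxK Gs mulmxA.
  have b0 x y : b x y = 0.
    have : Q (x + y) = (Q x + b x y) + (b y x + Q y).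
      rewrite /Q /b linearD /= !mulmxDl !mulmxDr.
      by rewrite mxE [X in X + _]mxE [X in _ + X]mxE.
    by rewrite !Q0 (bC y) => h; lra.
  apply/matrixP => i j; have := b0 (delta_mx 0 i) (delta_mx 0 j).
  by rewrite /b trmx_delta -rowE -colE !mxE.
have Qn : Q u < 0.
  by rewrite lt_def eq_sym u0 leNgt; apply/negP => h; apply: npos; exists u.
have [v] := norm1 u u0; rewrite ltr0_sg // => hv.
have e0 : -1 != 0 :> R by rewrite oppr_eq0 oner_neq0.
have [P [G' [Pu G's G'u PG]]] := split_vector Gs Gu e0 hv.
have [p [q sG]] := IHm _ G's G'u.
have [P' P'u P'G] := unit_block_signature Pu PG sG.
(* A positive entry left in the complement of v would be a positive vector. *)
case: p sG P'G => [sG P'G|p sG P'G]; last first.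
  have m_gt0 : (0 < m)%N by case: sG; lia.
  pose k := rshift 1 (Ordinal m_gt0).
  apply: False_ind; apply: npos; exists (row k P'); rewrite /Q.
  have -> : row k P' *m G *m (row k P')^T =
      delta_mx 0 k *m (P' *m G *m P'^T) *m (delta_mx 0 k)^T.
    by rewrite rowE trmx_mul !mulmxA.
  by rewrite P'G trmx_delta -rowE -colE mxE mxE block_mxEdr !mxE eqxx.
exists 0%N, q.+1; split; first by rewrite addnS (proj1 sG).
by exists P' => //; rewrite P'G (@block_sign_mx _ _ 0 0).
Qed.

End Sylvester.

(** * Z-bases *)

Lemma zmod_morphism_sum (A B : zmodType) (f : A -> B) (r : nat) (b : 'I_r -> A)
    (c : 'rV[int]_r) :
  zmod_morphism f -> f (\sum_i b i *~ c 0 i) = \sum_i f (b i) *~ c 0 i.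
Proof.
move=> fB; pose F := GRing.isZmodMorphism.Build A B f fB.
pose g : {additive A -> B} := HB.pack f F.
rewrite -[LHS]/(g _) raddf_sum; apply: eq_bigr => i _.
by rewrite raddfMz.
Qed.

Lemma zmod_morphism0 (A B : zmodType) (f : A -> B) :
  zmod_morphism f -> f 0 = 0.
Proof. by move=> fB; rewrite -[in LHS](subrr (0 : A)) fB subrr. Qed.

Section ZBasis.
Variables (A : zmodType) (r : nat) (b : 'I_r -> A) (hb : zbasis b).

Lemma zcoord_subproof x : exists c : 'rV_r, x = \sum_i b i *~ c 0 i.
Proof. by have [c [hc _]] := hb x; exists c. Qed.

Definition zcoord (x : A) : 'rV[int]_r := sval (cid (zcoord_subproof x)).

Lemma zcoordK x : \sum_i b i *~ zcoord x 0 i = x.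
Proof. by rewrite /zcoord; case: cid. Qed.

Lemma zcoord_uniq (c : 'rV_r) : zcoord (\sum_i b i *~ c 0 i) = c.
Proof.
have [d [_ dU]] := hb (\sum_i b i *~ c 0 i).
exact: etrans (esym (dU _ (esym (zcoordK _)))) (dU _ erefl).
Qed.

Lemma zcoordB : zmod_morphism zcoord.
Proof.
move=> x y; rewrite -[RHS]zcoord_uniq; congr zcoord.
rewrite -[in LHS](zcoordK x) -[in LHS](zcoordK y) -sumrB.
by apply: eq_bigr => i _; rewrite !mxE mulrzBr.
Qed.

Lemma zbasis_ext (B : zmodType) (f g : A -> B) :
  zmod_morphism f -> zmod_morphism g -> (forall i, f (b i) = g (b i)) -> f =1 g.
Proof.
move=> hf hg fg x; rewrite -(zcoordK x) !zmod_morphism_sum //.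
by apply: eq_bigr => i _; rewrite fg.
Qed.

End ZBasis.

(** The matrices of change of basis are inverse to each other over Z, and a matrix
    with a right inverse is at least as wide as high. *)
Lemma zbasis_rank_le (A : zmodType) r r' (b : 'I_r -> A) (b' : 'I_r' -> A) :
  zbasis b -> zbasis b' -> (r <= r')%N.
Proof.
move=> hb hb'; pose P := \matrix_(i, j) zcoord hb' (b i) 0 j.
pose Q := \matrix_(i, j) zcoord hb (b' i) 0 j.
apply: (@mulmx1_min _ _ _ P Q); apply/row_matrixP => i; rewrite row_mul.
rewrite -[RHS](zcoord_uniq hb) -[LHS](zcoord_uniq hb); congr zcoord.
transitivity (b i); last first.
  rewrite (bigD1 i) //= big1 ?addr0 => [|j ji]; first by rewrite !mxE eqxx.
  by rewrite !mxE eq_sym (negPf ji).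
transitivity (\sum_j b' j *~ P i j); last first.
  by rewrite -[RHS](zcoordK hb'); apply: eq_bigr => j _; rewrite mxE.
under [RHS]eq_bigr => j _ do rewrite -(zcoordK hb (b' j)) mulrz_suml.
rewrite exchange_big; apply: eq_bigr => k _; rewrite mxE mulrz_sumr.
apply: eq_bigr => j _; rewrite -mulrzA !mxE; congr (_ *~ _); exact: mulrC.
Qed.

Lemma zbasis_rank_uniq (A : zmodType) r r' (b : 'I_r -> A) (b' : 'I_r' -> A) :
  zbasis b -> zbasis b' -> r = r'.
Proof.
move=> h h'; apply/eqP.
by rewrite eqn_leq (zbasis_rank_le h h') (zbasis_rank_le h' h).
Qed.

(** * Linear algebra of the form on R^{n,n} *)

Section NarainForm.
Variables (R : realType) (n : nat).
Local Notation E := 'rV[R]_(n + n).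

(** Gram matrix of the form of R^{n,n}. *)
Definition nmx : 'M[R]_(n + n) := block_mx 1%:M 0 0 (- 1%:M).

Lemma nmx_tr : nmx^T = nmx.
Proof. by rewrite tr_block_mx linearN /= !trmx1 !trmx0. Qed.

Lemma nmxK : nmx *m nmx = 1%:M.
Proof.
rewrite mulmx_block !(mulmx0, mul0mx, addr0, add0r, mulmx1, mul1mx).
by rewrite mulNmx mulmxN opprK mulmx1 -scalar_mx_block.
Qed.

Lemma nmx_unit : nmx \in unitmx.
Proof. by case/mulmx1_unit: nmxK. Qed.

Lemma nmx_signature : mx_signature nmx n n.
Proof.
split=> //; exists 1%:M; rewrite ?unitmx1 // trmx1 mulmx1 mul1mx.
apply/matrixP => i j; case: (split_ordP i) => k ->; case: (split_ordP j) => l ->.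
- by rewrite block_mxEul !mxE /= ltn_ord eq_lshift.
- by rewrite block_mxEur !mxE eq_lrshift.
- by rewrite block_mxEdl !mxE eq_rlshift.
- by rewrite block_mxEdr !mxE /= ltnNge leq_addr eq_rshift mulNrn.
Qed.

Lemma nformE (x y : E) : nform x y = (x *m nmx *m y^T) 0 0.
Proof.
rewrite /nform -[in RHS](hsubmxK x) -[in RHS](hsubmxK y) mul_row_block.
rewrite !mulmx0 mulmx1 addr0 add0r mulmxN mulmx1 tr_row_mx mul_row_col mulNmx.
rewrite [RHS]mxE [X in _ = X + _]mxE [X in _ = _ + X]mxE [X in _ = _ - X]mxE.
by congr (_ - _); apply: eq_bigr => i _; rewrite !mxE.
Qed.

Lemma nform_mul k l (c : 'rV_k) (d : 'rV_l) (B : 'M[R]_(k, n + n)) B' :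
  nform (c *m B) (d *m B') = (c *m (B *m nmx *m B'^T) *m d^T) 0 0.
Proof. by rewrite nformE trmx_mul !mulmxA. Qed.

Lemma gramE k l (B : 'M[R]_(k, n + n)) (B' : 'M_(l, n + n)) i j :
  (B *m nmx *m B'^T) i j = nform (row i B) (row j B').
Proof.
rewrite !rowE nform_mul trmx_delta -rowE -colE.
by rewrite [RHS]mxE [RHS]mxE.
Qed.

Lemma nform_row k (z : E) (A : 'M[R]_(k, n + n)) l :
  nform z (row l A) = (z *m (nmx *m A^T)) 0 l.
Proof.
have {1}-> : z = row 0 z by apply/rowP => j; rewrite mxE.
by rewrite -gramE mulmxA.
Qed.

Lemma nformDl (x y z : E) : nform (x + y) z = nform x z + nform y z.
Proof. by rewrite !nformE !mulmxDl mxE. Qed.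

Lemma nformDr (x y z : E) : nform z (x + y) = nform z x + nform z y.
Proof. by rewrite !(nformC z) nformDl. Qed.

Lemma nformZl a (x z : E) : nform (a *: x) z = a * nform x z.
Proof. by rewrite !nformE -!scalemxAl mxE. Qed.

Lemma nformNl (x z : E) : nform (- x) z = - nform x z.
Proof. by rewrite -scaleN1r nformZl mulN1r. Qed.

Lemma nformNr (x z : E) : nform z (- x) = - nform z x.
Proof. by rewrite nformC nformNl nformC. Qed.

Lemma nformBl (x y z : E) : nform (x - y) z = nform x z - nform y z.
Proof. by rewrite nformDl nformNl. Qed.

Lemma nformBr (x y z : E) : nform z (x - y) = nform z x - nform z y.
Proof. by rewrite nformDr nformNr. Qed.

Lemma nform0l (z : E) : nform 0 z = 0.
Proof. by rewrite -[0 in LHS](subrr z) nformBl subrr. Qed.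

Lemma nformZr a (x z : E) : nform z (a *: x) = a * nform z x.
Proof. by rewrite nformC nformZl nformC. Qed.

Lemma nform_nondeg (x : E) : (forall y, nform x y = 0) -> x = 0.
Proof.
move=> h; have : x *m nmx = 0.
  apply/rowP => j; have := h (delta_mx 0 j).
  by rewrite nformE trmx_delta -colE !mxE.
by move/(congr1 (mulmx^~ nmx)); rewrite mul0mx -mulmxA nmxK mulmx1.
Qed.

Section BasisMatrix.
Variable U : {vspace E}.

Definition basis_mx k (B : 'M[R]_(k, n + n)) : Prop :=
  row_free B /\ forall u, u \in U <-> exists c : 'rV_k, u = c *m B.

Lemma basis_mx_vbasis : basis_mx (\matrix_(i < \dim U) (vbasis U)`_i).
Proof.
have sumE (c : 'rV_(\dim U)) :
    c *m (\matrix_(i < \dim U) (vbasis U)`_i) = \sum_i c 0 i *: (vbasis U)`_i.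
  by rewrite mulmx_sum_row; apply: eq_bigr => i _; rewrite rowK.
split; last first.
  move=> u; split=> [/coord_vbasis ->|[c ->]].
    exists (\row_i coord (vbasis U) i u); rewrite sumE.
    by apply: eq_bigr => i _; rewrite mxE.
  rewrite sumE; apply: memv_suml => i _; apply/memvZ/vbasis_mem/mem_nth.
  by rewrite size_tuple.
rewrite -kermx_eq0; apply/eqP/row_matrixP => i; rewrite row0; set v := row i _.
have : v *m (\matrix_(i < \dim U) (vbasis U)`_i) = 0.
  by rewrite /v -row_mul mulmx_ker row0.
rewrite sumE => v0; have /freeP/(_ (fun i => v 0 i) v0) h := basis_free (vbasisP U).
by apply/rowP => j; rewrite h mxE.
Qed.

Lemma row_free_mul k l (B : 'M[R]_(k, l)) (C : 'M_(l, n + n)) :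
  row_free C -> row_free (B *m C) = row_free B.
Proof. by move=> Cf; rewrite /row_free mxrankMfree. Qed.

Lemma row_free_factor k (B : 'M[R]_(k, n + n)) :
  row_free B -> (forall i, row i B \in U) ->
  exists2 P : 'M_(k, \dim U), row_free P &
    B = P *m (\matrix_(i < \dim U) (vbasis U)`_i).
Proof.
move=> Bf BU; have [Vf VU] := basis_mx_vbasis.
have /choice[c hc] i := (VU (row i B)).1 (BU i).
have eB : B = (\matrix_i c i) *m (\matrix_(i < \dim U) (vbasis U)`_i).
  by apply/row_matrixP => i; rewrite row_mul rowK.
by exists (\matrix_i c i) => //; rewrite -(row_free_mul _ Vf) -eB.
Qed.

Lemma row_free_dim k (B : 'M[R]_(k, n + n)) :
  row_free B -> (forall i, row i B \in U) -> (k <= \dim U)%N.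
Proof.
move=> Bf BU; have [P /eqP Pf _] := row_free_factor Bf BU.
by rewrite -[X in (X <= _)%N]Pf rank_leq_col.
Qed.

Lemma row_free_basis_mx k (B : 'M[R]_(k, n + n)) :
  row_free B -> (forall i, row i B \in U) -> k = \dim U -> basis_mx B.
Proof.
move=> Bf BU ek; split=> // u; split=> [uU|[c ->]]; last first.
  by rewrite mulmx_sum_row; apply: memv_suml => i _; apply/memvZ/BU.
have [P Pf eB] := row_free_factor Bf BU.
have [_ VU] := basis_mx_vbasis; have [c hc] := (VU u).1 uU.
have /row_fullP[Q QP] : row_full P by rewrite /row_full (eqP Pf) ek.
by exists (c *m Q); rewrite eB -mulmxA [Q *m _]mulmxA QP mul1mx.
Qed.

Lemma basis_mx_row k (B : 'M[R]_(k, n + n)) i : basis_mx B -> row i B \in U.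
Proof. by case=> _ h; apply/h; exists (delta_mx 0 i); rewrite -rowE. Qed.

Lemma subspace_signatureP k (B : 'M[R]_(k, n + n)) p q :
  basis_mx B -> k = \dim U ->
  subspace_signature U p q <-> mx_signature (B *m nmx *m B^T) p q.
Proof.
move=> hB ek; have [P Pf eB] := row_free_factor hB.1 (fun i => basis_mx_row i hB).
rewrite /subspace_signature; set G := (\matrix_(i, j) _).
apply: iff_sym; apply: (mx_signature_congr p q _ Pf) => //.
rewrite {1 2}eB trmx_mul !mulmxA; congr (_ *m _); rewrite -!mulmxA; congr (_ *m _).
by apply/matrixP => i j; rewrite mulmxA gramE !rowK mxE.
Qed.

End BasisMatrix.

(** Symmetric in U and W, so that every statement about V applies to V^perp. *)
Definition orth_split (U W : {vspace E}) : Prop :=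
  (forall x, exists u w, [/\ u \in U, w \in W & x = u + w]) /\
  (forall u w, u \in U -> w \in W -> nform u w = 0).

Lemma orth_splitC U W : orth_split U W -> orth_split W U.
Proof.
case=> h o; split=> [x|w u wW uU]; last by rewrite nformC o.
by have [u [w [uU wW ->]]] := h x; exists w, u; rewrite addrC.
Qed.

Lemma orth_split_nondeg U W u : orth_split U W -> u \in U ->
  (forall u', u' \in U -> nform u u' = 0) -> u = 0.
Proof.
case=> h o uU hu; apply: nform_nondeg => x; have [u' [w [u'U wW ->]]] := h x.
by rewrite nformDr hu // o // addr0.
Qed.

Lemma orth_split_uniq U W u w u' w' : orth_split U W ->
  u \in U -> w \in W -> u' \in U -> w' \in W -> u + w = u' + w' ->
  u = u' /\ w = w'.
Proof.
move=> h uU wW u'U w'W e; suff eu : u = u'.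
  by split=> //; move: e; rewrite eu => /addrI.
apply/eqP; rewrite -subr_eq0; apply/eqP/(orth_split_nondeg h); first exact: rpredB.
move=> x xU; have -> : u - u' = w' - w.
  by apply/eqP; rewrite subr_eq addrAC eq_sym subr_eq [w' + _]addrC e.
by rewrite nformC nformBr !h.2 // subrr.
Qed.

Lemma orth_split_mem U W x : orth_split U W ->
  (forall w, w \in W -> nform x w = 0) -> x \in U.
Proof.
move=> h hx; have [u [w [uU wW e]]] := h.1 x.
suff w0 : w = 0 by rewrite e w0 addr0.
apply: (orth_split_nondeg (orth_splitC h)) => // w' w'W.
by have := hx _ w'W; rewrite e nformDl h.2 // add0r.
Qed.

Lemma basis_gram_unit U W k (B : 'M[R]_(k, n + n)) :
  orth_split U W -> basis_mx U B -> B *m nmx *m B^T \in unitmx.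
Proof.
move=> h [Bf BU]; rewrite -row_free_unit -kermx_eq0.
apply/eqP/row_matrixP => i; rewrite row0; set v := row i _.
have v0 : v *m (B *m nmx *m B^T) = 0 by rewrite /v -row_mul mulmx_ker row0.
apply: (row_free_inj Bf); rewrite mul0mx; apply: (orth_split_nondeg h).
  by apply/BU; exists v.
by move=> u' /BU[c ->]; rewrite nform_mul v0 mul0mx mxE.
Qed.

Lemma basis_mx_col U W k l (B : 'M[R]_(k, n + n)) (C : 'M[R]_(l, n + n)) :
  orth_split U W -> basis_mx U B -> basis_mx W C ->
  row_free (col_mx B C) /\ row_full (col_mx B C).
Proof.
move=> h [Bf BU] [Cf CW]; split.
  rewrite -kermx_eq0; apply/eqP/row_matrixP => i; rewrite row0; set v := row i _.
  have : v *m col_mx B C = 0 by rewrite /v -row_mul mulmx_ker row0.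
  rewrite -[v]hsubmxK mul_row_col -[RHS]addr0 => /(orth_split_uniq h)[].
  - by apply/BU; exists (lsubmx v).
  - by apply/CW; exists (rsubmx v).
  - exact: rpred0.
  - exact: rpred0.
  rewrite -{1}(mul0mx _ B) => /(row_free_inj Bf)->.
  by rewrite -(mul0mx _ C) => /(row_free_inj Cf)->; rewrite row_mx0.
have /choice[P hP] (i : 'I_(n + n)) :
    exists c : 'rV_(k + l), c *m col_mx B C = delta_mx 0 i.
  have [u [w [/BU[c ->] /CW[d ->] ->]]] := h.1 (delta_mx 0 i).
  by exists (row_mx c d); rewrite mul_row_col.
apply/row_fullP; exists (\matrix_i P i); apply/row_matrixP => i.
by rewrite row_mul rowK hP rowE mulmx1.
Qed.

End NarainForm.

(** * Lattices embedded in a real subspace, and their duals *)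

Section Embedding.
Variables (R : realType) (n : nat).
Local Notation E := 'rV[R]_(n + n).

(** An embedding of X as a full lattice of U that multiplies the form by [eps]. The
    sign [eps] = -1 describes an embedding of X(-1) without changing X. *)
Definition embeds (eps : R) (U : {vspace E}) (X : preLattice) (i : X -> E) : Prop :=
  [/\ zmod_morphism i,
      forall x y, nform (i x) (i y) = eps * (pl_form x y)%:~R
    & exists b : 'I_n -> X, zbasis b /\ basis_mx U (\matrix_(k < n) i (b k))].

(** The functional a is [eps] times the pairing with v: with the sign, the elements
    of the lattice represent their own image in the dual. *)
Definition represents (eps : R) (X : preLattice) (i : X -> E) (a : dual X) (v : E) :=
  forall x, (val a x)%:~R = eps * nform v (i x).

Lemma dual_morphism (X : preLattice) (a : dual X) : zmod_morphism (val a).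
Proof. exact/asboolP/(valP a). Qed.

Lemma mem_dual (X : preLattice) (f : X -> int) :
  zmod_morphism f -> exists a : dual X, val a = f.
Proof. by move=> fB; exists (exist _ f (introT (asboolP _) fB)). Qed.

Lemma zmod_morphism_rmx r (A : zmodType) (b : 'I_r -> A) (hb : zbasis b)
    (i : A -> E) : zmod_morphism i ->
  forall x, i x = rmx (zcoord hb x) *m (\matrix_(k < r) i (b k)).
Proof.
move=> iB x; rewrite -{1}(zcoordK hb x) zmod_morphism_sum // mulmx_sum_row.
by apply: eq_bigr => k _; rewrite rowK mxE scaler_int.
Qed.

Lemma representsB eps (X : preLattice) (i : X -> E) a a' v v' :
  represents eps i a v -> represents eps i a' v' ->
  represents eps i (a - a') (v - v').
Proof.
move=> h h' x; rewrite nformBl mulrBr -h -h' -intrB.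
by congr (_%:~R).
Qed.

Lemma represents_fun eps (X : preLattice) (i : X -> E) a a' v :
  represents eps i a v -> represents eps i a' v -> a = a'.
Proof.
move=> h h'; apply/val_inj/funext => x; apply: (@intr_inj R).
by rewrite h h'.
Qed.

Lemma represents0 eps (X : preLattice) (i : X -> E) : represents eps i 0 0.
Proof. by move=> x; rewrite nform0l mulr0. Qed.

Lemma sign_neq0 (eps : R) : eps * eps = 1 -> eps != 0.
Proof.
by move=> h; apply/eqP => e; have := oner_neq0 R; rewrite -h e mul0r eqxx.
Qed.

Section Theory.
Variables (eps : R) (U W : {vspace E}) (X : preLattice) (i : X -> E).
Hypotheses (eps2 : eps * eps = 1) (UW : orth_split U W) (hi : embeds eps U i).

Lemma embeds_mem x : i x \in U.
Proof.
case: hi => iB _ [b [hb [_ hU]]]; apply/hU; exists (rmx (zcoord hb x)).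
exact: zmod_morphism_rmx.
Qed.

Lemma embeds_eq0 u : u \in U -> (forall x, nform u (i x) = 0) -> u = 0.
Proof.
case: hi => iB _ [b [hb [_ hU]]] uU hu; apply: (orth_split_nondeg UW) => //.
move=> u' /hU[c ->]; rewrite mulmx_sum_row.
elim/big_ind: _ => [|y z hy hz|k _].
- by rewrite nformC nform0l.
- by rewrite nformDr hy hz addr0.
- by rewrite rowK nformZr hu mulr0.
Qed.

Lemma embeds_inj : injective i.
Proof.
case: hi => iB _ [b [hb [Bf _]]] x y; rewrite !(zmod_morphism_rmx hb iB).
by move=> /(row_free_inj Bf)/rmx_inj e; rewrite -(zcoordK hb x) e zcoordK.
Qed.

Lemma represents_uniq a v v' : v \in U -> v' \in U ->
  represents eps i a v -> represents eps i a v' -> v = v'.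
Proof.
move=> vU v'U h h'; apply/eqP; rewrite -subr_eq0; apply/eqP/embeds_eq0.
  exact: rpredB.
move=> x; apply: (mulfI (sign_neq0 eps2)); rewrite mulr0 nformBl mulrBr.
by rewrite -h -h' subrr.
Qed.

Lemma represents_to_dual x : represents eps i (to_dual x) (i x).
Proof. by case: hi => _ h _ y; rewrite h mulrA eps2 mul1r. Qed.

(** The rows of D are, up to sign, the dual basis of a basis of X. *)
Lemma dual_lattice_basis :
  exists2 D : 'M[R]_(n, n + n), basis_mx U D &
    forall a : dual X, exists z : 'rV[int]_n, represents eps i a (rmx z *m D).
Proof.
case: hi => iB _ [b [hb hB]]; set B := (\matrix_(k < n) _) in hB.
have Gu := basis_gram_unit UW hB; set G := B *m _ *m _ in Gu.
have Gs : G^T = G by rewrite !trmx_mul trmxK nmx_tr mulmxA.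
have e0 : eps \is a GRing.unit by apply/unitrPr; exists eps.
have Pu : eps *: invmx G \in unitmx by rewrite unitmxZ // unitmx_inv.
exists (eps *: invmx G *m B).
  split; first by rewrite row_free_mul ?hB.1 // row_free_unit.
  move=> u; rewrite hB.2; split=> -[c ->].
    by exists (c *m invmx (eps *: invmx G)); rewrite !mulmxA mulmxKV.
  by exists (c *m (eps *: invmx G)); rewrite -mulmxA.
move=> a; exists (\row_k val a (b k)) => x.
rewrite (zmod_morphism_rmx hb iB) -/B mulmxA nform_mul -/G.
rewrite -scalemxAr -!scalemxAl mulmxKV // mxE mulrA eps2 mul1r mxE.
rewrite -{1}(zcoordK hb x) zmod_morphism_sum; last exact: dual_morphism.
rewrite rmorph_sum; apply: eq_bigr => k _; rewrite !mxE /=.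
by rewrite -[val a _ *~ _]mulrzr intz intrM.
Qed.

Lemma represents_ex a : exists2 v, v \in U & represents eps i a v.
Proof.
have [D [_ hD] h] := dual_lattice_basis; have [z hz] := h a.
by exists (rmx z *m D) => //; apply/hD; exists (rmx z).
Qed.

Lemma sign_cases : eps = 1 \/ eps = -1.
Proof.
have : (eps - 1) * (eps + 1) == 0 by rewrite mulrBl !mulrDr eps2; apply/eqP; ring.
by rewrite mulf_eq0 subr_eq0 addr_eq0 => /orP[]/eqP; [left|right].
Qed.

Lemma sign_int r : (eps * r \is a Num.int) = (r \is a Num.int).
Proof. by case: sign_cases => ->; rewrite ?mul1r // mulN1r rpredN. Qed.

Lemma represents_of_int v :
  (forall x, nform v (i x) \is a Num.int) -> exists a, represents eps i a v.
Proof.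
move=> hv; have hf x : (Num.floor (eps * nform v (i x)))%:~R = eps * nform v (i x).
  by apply/eqP; rewrite -intrEfloor sign_int.
have [|a ha] := @mem_dual X (fun x => Num.floor (eps * nform v (i x))).
  move=> x y; apply: (@intr_inj R); rewrite intrB !hf.
  by case: hi => -> _ _; rewrite nformBr mulrBr.
by exists a => x; rewrite ha hf.
Qed.

(** The coordinates of u in a basis of X are its pairings with the dual basis, up
    to sign. *)
Lemma bidual u : u \in U ->
  (forall a v, v \in U -> represents eps i a v -> nform u v \is a Num.int) ->
  exists x, u = i x.
Proof.
case: hi => iB _ [b [hb hB]]; set B := (\matrix_(k < n) _) in hB.
move=> /hB.2[c ->] hu; suff cint k : c 0 k \is a Num.int.
  exists (\sum_k b k *~ Num.floor (c 0 k)).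
  have := @zmod_morphism_sum _ _ i _ b (\row_k Num.floor (c 0 k)) iB.
  under eq_bigr => k _ do rewrite mxE.
  move=> ->; rewrite mulmx_sum_row; apply: eq_bigr => k _.
  by rewrite rowK mxE -scaler_int; congr (_ *: _); apply/esym/eqP; rewrite -intrEfloor.
have [|a ha] := @mem_dual X (fun x => zcoord hb x 0 k).
  by move=> x y; rewrite zcoordB !mxE.
have [v vU av] := represents_ex a.
have <- : eps * nform (c *m B) v = c 0 k; last by rewrite sign_int; apply: hu av.
rewrite nformC mulmx_sum_row.
transitivity (\sum_l c 0 l * (k == l)%:R); last first.
  rewrite (bigD1 k) //= big1 => [|l lk]; first by rewrite eqxx mulr1 addr0.
  by rewrite eq_sym (negPf lk) mulr0.
have -> : nform v (\sum_l c 0 l *: row l B) = \sum_l c 0 l * nform v (row l B).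
  elim/big_rec2: _ => [|l y z _ <-]; first by rewrite nformC nform0l.
  by rewrite nformDr nformZr.
rewrite mulr_sumr; apply: eq_bigr => l _; rewrite mulrCA rowK -av ha.
have -> : b l = \sum_j b j *~ (delta_mx 0 l : 'rV[int]_n) 0 j.
  rewrite (bigD1 l) //= big1 => [|j jl]; first by rewrite mxE !eqxx addr0.
  by rewrite mxE (negPf jl).
by rewrite zcoord_uniq mxE eqxx; case: (k == l).
Qed.

Lemma disc_pi_repr a a' v v' : v \in U -> v' \in U ->
  represents eps i a v -> represents eps i a' v' ->
  disc_pi a = disc_pi a' <-> exists x, v = v' + i x.
Proof.
move=> vU v'U h h'; rewrite disc_piP; split=> -[x e]; exists x.
  apply/eqP; rewrite addrC -subr_eq; apply/eqP.
  apply: (@represents_uniq (a - a'));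
    [exact: rpredB | exact: embeds_mem | exact: representsB |].
  by rewrite e addrC addKr; apply: represents_to_dual.
apply/eqP; rewrite addrC -subr_eq; apply/eqP.
apply: represents_fun (representsB h h') _.
by rewrite e addrC addKr; apply: represents_to_dual.
Qed.

(** Cramer's rule: the determinant of the Gram matrix is a common denominator for
    the dual lattice. *)
Lemma dual_square_ex (a : dual X) : exists r, dual_square a r.
Proof.
case: hi => iB iform [b [hb hB]]; set B := (\matrix_(k < n) _) in hB.
pose Gz := \matrix_(k, l) pl_form (b k) (b l).
have eG : B *m nmx R n *m B^T = eps *: rmx Gz.
  by apply/matrixP => k l; rewrite gramE !rowK iform !mxE.
have d0 : \det Gz != 0.
  have := basis_gram_unit UW hB; rewrite eG unitmxE detZ unitrM det_map_mx => /andP[_].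
  by rewrite unitfE intr_eq0.
pose c := (\row_k val a (b k)) *m \adj Gz.
pose x := \sum_k b k *~ c 0 k.
exists ((val a x)%:~R / (\det Gz)%:~R); exists (\det Gz), x; split=> // y.
have fl z : zmod_morphism (pl_form^~ z : X -> int) by move=> ? ?; rewrite pl_formB.
apply: (@zbasis_ext _ _ _ hb _ (fun y => \det Gz * val a y)) => [||l].
- by move=> u w; rewrite dual_morphism mulrBr.
- by move=> u w; rewrite ![pl_form x _]pl_formC fl.
rewrite /x -[pl_form _ _]/((pl_form^~ (b l)) _) zmod_morphism_sum //.
have : c *m Gz = \det Gz *: \row_k val a (b k).
  by rewrite -mulmxA mul_adj_mx mul_mx_scalar.
move/rowP/(_ l); rewrite [RHS]mxE [X in _ = _ * X]mxE => <-; rewrite mxE.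
by apply: eq_bigr => k _; rewrite -[pl_form _ _ *~ _]mulrzr intz mulrC mxE.
Qed.

(** Two descriptions of the square of an element of the dual lattice: by
    denominators inside X, or as a real vector. *)
Lemma dual_norm_repr (a : dual X) v : v \in U -> represents eps i a v ->
  ratr (dual_norm a) = eps * nform v v.
Proof.
move=> vU av; have [r hr] := dual_square_ex a.
rewrite /dual_norm (xget_subset1 _ hr) => [|s t]; last exact: dual_square_uniq.
case: hr => m [x [m0 hx ->]].
have mR : m%:~R != 0 :> R by rewrite intr_eq0.
have mv : m%:~R *: v = i x.
  apply/eqP; rewrite -subr_eq0; apply/eqP/embeds_eq0.
    by rewrite rpredB ?embeds_mem // rpredZ.
  move=> y; rewrite nformBl nformZl; case: hi => _ -> _.
  rewrite -hx intrM av mulrCA [eps * (eps * _)]mulrA eps2 mul1r.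
  by rewrite -[_ * nform _ _]/(_ * _) subrr.
rewrite fmorph_div /= !ratr_int av -mv nformZr mulrCA mulrAC divff // mul1r.
by [].
Qed.

End Theory.
End Embedding.

(** * Subgroups of R^{n,n} given by a basis *)

Section IntSubgroups.
Variables (R : realType) (n : nat).
Local Notation E := 'rV[R]_(n + n).

Section Build.
Variable P : E -> Prop.
Hypotheses (P0 : P 0) (PB : forall x y, P x -> P y -> P (x - y)).
Hypothesis P_int : forall x y, P x -> P y -> nform x y \is a Num.int.

Definition prop_pred : {pred E} := fun x => `[< P x >].

Lemma prop_pred_zmod : zmod_closed prop_pred.
Proof.
split; first exact/asboolP.
by move=> x y /asboolP hx /asboolP hy; apply/asboolP/PB.
Qed.

HB.instance Definition _ := GRing.isZmodClosed.Build E prop_pred prop_pred_zmod.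

Lemma prop_pred_int : {in prop_pred &, forall x y, nform x y \is a Num.int}.
Proof. by move=> x y /asboolP hx /asboolP hy; apply: P_int. Qed.

Lemma exists_intSubgroup :
  exists G : intSubgroup R n, forall x, x \in int_sub G <-> P x.
Proof. by exists (IntSubgroup prop_pred_int) => x; split=> /asboolP. Qed.

End Build.

Definition lattice_mx (P : E -> Prop) r (A : 'M[R]_(r, n + n)) : Prop :=
  row_free A /\ forall z, P z <-> exists c : 'rV[int]_r, z = rmx c *m A.

Lemma sublattice_mx (P : E -> Prop) k (D : 'M[R]_(k, n + n)) :
  P 0 -> (forall x y, P x -> P y -> P (x - y)) -> row_free D ->
  (forall z, P z -> exists c : 'rV[int]_k, z = rmx c *m D) ->
  exists r (A : 'M[R]_(r, n + n)), (r <= k)%N /\ lattice_mx P A.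
Proof.
move=> P0 PB Df PD.
have rmxB (c d : 'rV[int]_k) : rmx (c - d) *m D = rmx c *m D - rmx d *m D.
  by rewrite map_mxB mulmxBl.
have [||r [B [rk HB BH Bf]]] := subgroup_basis R (H := fun c : 'rV_k => P (rmx c *m D)).
- by rewrite map_mx0 mul0mx.
- by move=> c d hc hd; rewrite rmxB; apply: PB.
exists r, (rmx B *m D); split=> //; split; first by rewrite row_free_mul.
move=> z; split=> [Pz|[c ->]]; last by rewrite mulmxA -map_mxM; apply: HB.
have [d ed] := PD z Pz; rewrite ed in Pz; have [c ec] := BH d Pz.
by exists c; rewrite ed ec map_mxM mulmxA.
Qed.

(** A subgroup of a full lattice that spans R^{n,n} is a full lattice: its rank is
    at most that of the big one, and spanning forces equality. *)
Lemma full_lattice_mx (P : E -> Prop) (D F : 'M[R]_(n + n)) :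
  P 0 -> (forall x y, P x -> P y -> P (x - y)) -> row_free D ->
  (forall z, P z -> exists c : 'rV[int]_(n + n), z = rmx c *m D) ->
  row_free F -> (forall i, P (row i F)) ->
  exists A : 'M[R]_(n + n), lattice_mx P A.
Proof.
move=> P0 PB Df PD Ff FP; have [r [A [_ hA]]] := sublattice_mx P0 PB Df PD.
have er : r = (n + n)%N.
  apply/eqP; rewrite eqn_leq; apply/andP; split.
    by case: hA => /eqP rA _; rewrite -[X in (X <= _)%N]rA rank_leq_col.
  have /choice[c hc] i := (hA.2 (row i F)).1 (FP i).
  have eF : F = (\matrix_i rmx (c i)) *m A.
    by apply/row_matrixP => i; rewrite row_mul rowK.
  have /eqP rF := Ff; rewrite -[X in (X <= _)%N]rF eF.
  by apply: leq_trans (mxrankM_maxr _ _) _; apply: rank_leq_row.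
by subst r; exists A.
Qed.

Section LatticeMatrix.
Variables (G : intSubgroup R n) (r : nat) (A : 'M[R]_(r, n + n)).
Hypothesis hA : lattice_mx (fun z => z \in int_sub G) A.

Lemma lattice_mx_row k : row k A \in int_sub G.
Proof.
apply/hA.2; exists (delta_mx 0 k); rewrite rowE; congr (_ *m _).
by apply/rowP => j; rewrite !mxE; case: andP.
Qed.

Lemma lattice_mx_zbasis :
  exists b : 'I_r -> subgroup_lattice G,
    zbasis b /\ forall k, val (b k) = row k A.
Proof.
pose b k : subgroup_lattice G := exist _ (row k A) (lattice_mx_row k).
have vB : zmod_morphism (val : subgroup_lattice G -> E) by move=> x y; rewrite raddfB.
have sumE (c : 'rV_r) : val (\sum_k b k *~ c 0 k) = rmx c *m A.
  rewrite (zmod_morphism_sum b c vB) mulmx_sum_row.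
  by apply: eq_bigr => k _; rewrite mxE scaler_int.
exists b; split=> // x; have [c hc] := (hA.2 (val x)).1 (valP x).
exists c; split; first by apply: val_inj; rewrite sumE.
move=> d /(congr1 val); rewrite sumE hc => /(row_free_inj hA.1).
exact: rmx_inj.
Qed.

End LatticeMatrix.

Lemma zbasis_iso (X Y : preLattice) (f : lat_iso X Y) r (b : 'I_r -> X) :
  zbasis b -> zbasis (f \o b).
Proof.
move=> hb y; have [c [hc cU]] := hb (li_inv f y); exists c; split.
  by rewrite -{1}[y](li_invK f) {1}hc (zmod_morphism_sum b c (li_add f)).
move=> d hd; apply: cU; apply: (can_inj (li_funK f)); rewrite li_invK hd.
by rewrite (zmod_morphism_sum b d (li_add f)).
Qed.

Lemma lat_iso_of_image eps U (X Q : preLattice) (i : X -> E) (q : Q -> E) :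
  eps * eps = 1 -> embeds eps U i -> zmod_morphism q -> injective q ->
  (forall x y, nform (q x) (q y) = eps * (pl_form x y)%:~R) ->
  (forall x, exists y, i x = q y) -> (forall y, exists x, i x = q y) ->
  exists f : lat_iso X Q, forall x, q (f x) = i x.
Proof.
move=> eps2 hi qB q_inj q_form /choice[f hf] /choice[g hg].
have fK : cancel f g by move=> x; apply: (embeds_inj hi); rewrite hg hf.
have gK : cancel g f by move=> y; apply: q_inj; rewrite -hf hg.
have fB : zmod_morphism f.
  by move=> x y; apply: q_inj; rewrite qB -!hf; case: hi => ->.
have ff x y : pl_form (f x) (f y) = pl_form x y.
  apply: (@intr_inj R); apply: (mulfI (sign_neq0 eps2)).
  by rewrite -q_form -!hf; case: hi => _ ->.
by exists (LatIso fK gK fB ff).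
Qed.

Definition even_set (P : E -> Prop) : Prop :=
  forall z, P z -> exists k : int, nform z z = (2 * k)%:~R.

(** Polarization: the three squares involved are even. *)
Lemma even_set_int (P : E -> Prop) : (forall x y, P x -> P y -> P (x - y)) ->
  even_set P -> forall x y, P x -> P y -> nform x y \is a Num.int.
Proof.
move=> PB Pe x y Px Py; have [k hk] := Pe _ Px; have [l hl] := Pe _ Py.
have [m] := Pe _ (PB _ _ Px Py); rewrite nformBl !nformBr (nformC y) hk hl => hm.
have -> : nform x y = (k + l - m)%:~R; last exact: intr_int.
move: hm; rewrite !(intrM, intrD, intrN); lra.
Qed.

(** For a full lattice, unimodularity only asks that the dual lattice in R^{n,n} be
    contained in G, and the signature (n, n) is that of R^{n,n}. *)
Lemma narain_criterion (G : intSubgroup R n) (A : 'M[R]_(n + n)) :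
  lattice_mx (fun z => z \in int_sub G) A ->
  even_set (fun z => z \in int_sub G) ->
  (forall z, (forall g, g \in int_sub G -> nform z g \is a Num.int) ->
     z \in int_sub G) ->
  narain G.
Proof.
move=> hA ev dualG; have [b [hb bA]] := lattice_mx_zbasis hA.
have Au : A \in unitmx by rewrite -row_free_unit hA.1.
have vB : zmod_morphism (val : subgroup_lattice G -> E) by move=> x y; rewrite raddfB.
have Anondeg z : (forall k, nform z (row k A) = 0) -> z = 0.
  move=> hz; have : z *m (nmx R n *m A^T) = 0.
    by apply/rowP => k; rewrite [RHS]mxE -nform_row.
  move/(congr1 (mulmx^~ (invmx (nmx R n *m A^T)))); rewrite mul0mx mulmxK //.
  by rewrite unitmx_mul unitmx_tr nmx_unit.
split.
- split; first by exists (n + n)%N, b.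
    move=> x; have [k hk] := ev _ (valP x); apply/dvdzP; exists k.
    by apply: (@intr_inj R); rewrite subgroup_formE hk mulrC.
  move=> x hx; apply: val_inj; rewrite (zmod_morphism0 vB); apply: Anondeg => k.
  by rewrite -bA -subgroup_formE [subgroup_form _ _]hx.
- move=> a; pose c : 'rV[R]_(n + n) := \row_k (val a (b k))%:~R.
  pose z := c *m invmx (nmx R n *m A^T).
  have hz (g : subgroup_lattice G) : nform z (val g) = (val a g)%:~R.
    have zB : zmod_morphism (fun g : subgroup_lattice G => nform z (val g)).
      by move=> x y; rewrite vB nformBr.
    have aB : zmod_morphism (fun g => (val a g)%:~R : R).
      by move=> x y; rewrite dual_morphism intrB.
    apply: (zbasis_ext hb zB aB) => k; rewrite bA nform_row mulmxKV ?mxE //.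
    by rewrite unitmx_mul unitmx_tr nmx_unit.
  have zG : z \in int_sub G.
    by apply: dualG => g gG; have := hz (exist _ g gG) => /= ->; apply: intr_int.
  exists (exist _ z zG); apply/val_inj/funext => g; apply: (@intr_inj R).
  by rewrite /= subgroup_formE -hz.
- exists (n + n)%N, b; split=> //.
  apply/(mx_signature_congr n n _ (P := A)); last exact: nmx_signature.
  - by [].
  - exact: hA.1.
  - apply/matrixP => k l; rewrite gramE mxE -[pl_form _ _]/(subgroup_form _ _).
    by rewrite subgroup_formE !bA.
Qed.

End IntSubgroups.

(** * Gluing two lattices along an isometry of discriminant groups *)

Lemma Q2Z_eq (r s : rat) :
  (\pi_(Q2Z) r = \pi_(Q2Z) s)%qT <-> exists k : int, r - s = (2 * k)%:~R.
Proof.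
split=> [/eqP|[k hk]].
  rewrite -Quotient.idealrBE unfold_in => /intrP[k hk]; exists k.
  by rewrite intrM -hk mulrC divfK.
apply/eqP; rewrite -Quotient.idealrBE unfold_in hk intrM mulrC mulKf //.
Qed.

Section Glue.
Variables (R : realType) (n : nat).
Local Notation E := 'rV[R]_(n + n).

Definition glued (e1 e2 : R) (X Y : preLattice) (i : X -> E) (j : Y -> E)
    (phi : disc Y -> disc X) (v w : E) : Prop :=
  exists (b : dual X) (a : dual Y), [/\ represents e1 i b v,
    represents e2 j a w & phi (disc_pi a) = disc_pi b].

Lemma disc_pi0 (X : preLattice) : disc_pi (0 : dual X) = 0.
Proof. exact: zmod_morphism0 (@disc_piB X). Qed.

Lemma disc_pi_to_dual (X : preLattice) (x : X) : disc_pi (to_dual x) = 0.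
Proof. by rewrite -disc_pi0; apply/disc_piP; exists x; rewrite add0r. Qed.

Section GlueTheory.
Variables (e1 e2 : R) (U W : {vspace E}) (X Y : preLattice).
Variables (i : X -> E) (j : Y -> E) (phi : disc_iso Y X).
Hypotheses (e1e1 : e1 * e1 = 1) (e2e2 : e2 * e2 = 1) (UW : orth_split U W).
Hypotheses (hi : embeds e1 U i) (hj : embeds e2 W j).
Local Notation glued := (glued e1 e2 i j phi).

Let WU : orth_split W U := orth_splitC UW.

Lemma glued0 : glued 0 0.
Proof.
exists 0, 0; split; [exact: represents0 | exact: represents0 |].
by rewrite !disc_pi0 (zmod_morphism0 (di_add phi)).
Qed.

Lemma gluedB v w v' w' : glued v w -> glued v' w' -> glued (v - v') (w - w').
Proof.
move=> [b [a [h1 h2 e]]] [b' [a' [h1' h2' e']]]; exists (b - b'), (a - a').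
by split; [exact: representsB | exact: representsB | rewrite !disc_piB di_add e e'].
Qed.

Lemma glued_ex_left w : (exists a, represents e2 j a w) ->
  exists2 v, v \in U & glued v w.
Proof.
case=> a ha; have [v vU hv] := represents_ex e1e1 UW hi (disc_repr (phi (disc_pi a))).
by exists v => //; exists (disc_repr (phi (disc_pi a))), a; rewrite disc_reprK.
Qed.

Lemma glued_ex_right v : (exists b, represents e1 i b v) ->
  exists2 w, w \in W & glued v w.
Proof.
case=> b hb; set a := disc_repr (di_inv phi (disc_pi b)).
have [w wW hw] := represents_ex e2e2 WU hj a.
by exists w => //; exists b, a; rewrite disc_reprK di_invK.
Qed.

Lemma glued_lattice_left v : v \in U -> glued v 0 <-> exists x, v = i x.
Proof.
move=> vU; split=> [[b [a [hb ha e]]]|[x ->]].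
  have a0 : a = 0 by apply: represents_fun ha (represents0 _ _).
  have : disc_pi b = disc_pi 0.
    by rewrite -e a0 !disc_pi0 (zmod_morphism0 (di_add phi)).
  move/(disc_pi_repr e1e1 UW hi vU (rpred0 _) hb (represents0 _ _))=> [x ->].
  by exists x; rewrite add0r.
exists (to_dual x), 0; split; [exact: represents_to_dual hi _ | exact: represents0 |].
by rewrite disc_pi0 disc_pi_to_dual (zmod_morphism0 (di_add phi)).
Qed.

Lemma glued_lattice_right w : w \in W -> glued 0 w <-> exists y, w = j y.
Proof.
move=> wW; split=> [[b [a [hb ha e]]]|[y ->]].
  have b0 : b = 0 by apply: represents_fun hb (represents0 _ _).
  have : disc_pi a = disc_pi 0.
    apply: (can_inj (di_funK phi)).
    by rewrite e b0 !disc_pi0 (zmod_morphism0 (di_add phi)).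
  move/(disc_pi_repr e2e2 WU hj wW (rpred0 _) ha (represents0 _ _))=> [y ->].
  by exists y; rewrite add0r.
exists 0, (to_dual y); split; [exact: represents0 | exact: represents_to_dual hj _ |].
by rewrite disc_pi0 disc_pi_to_dual (zmod_morphism0 (di_add phi)).
Qed.

(** [phi] preserves the quadratic forms of the discriminant groups. For
    [e1] = 1 and [e2] = -1 the left-hand side is the square of v + w. *)
Lemma glued_norm v w : even_lattice X -> even_lattice Y ->
  v \in U -> w \in W -> glued v w ->
  exists k : int, e1 * nform v v - e2 * nform w w = (2 * k)%:~R.
Proof.
move=> evX evY vU wW [b [a [hb ha e]]].
have : disc_q (disc_pi b) = disc_q (disc_pi a) by rewrite -e di_q.
rewrite !disc_qE // => /Q2Z_eq[k hk]; exists k.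
rewrite -(dual_norm_repr e1e1 UW hi vU hb) -(dual_norm_repr e2e2 WU hj wW ha).
by rewrite -rmorphB /= hk ratr_int.
Qed.

End GlueTheory.
End Glue.

(** * The glue of two lattices is a Narain lattice *)

Section GlueLattice.
Variables (R : realType) (n : nat).
Local Notation E := 'rV[R]_(n + n).
Variables (U W : {vspace E}) (X Y : evenLattice) (i : X -> E) (j : Y -> E).
Variable phi : disc_iso Y X.
Hypotheses (UW : orth_split U W) (hi : embeds 1 U i) (hj : embeds (-1) W j).
Local Notation glued := (glued 1 (-1) i j phi).

Let one2 : 1 * 1 = 1 :> R. Proof. exact: mulr1. Qed.
Let mone2 : -1 * -1 = 1 :> R. Proof. by rewrite mulrNN mulr1. Qed.
Let WU : orth_split W U := orth_splitC UW.

Definition glue_set (z : E) : Prop :=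
  exists v w, [/\ v \in U, w \in W, z = v + w & glued v w].

Lemma glue_setP v w : v \in U -> w \in W -> glue_set (v + w) <-> glued v w.
Proof.
move=> vU wW; split=> [[v' [w' [v'U w'W e h]]]|h]; last by exists v, w.
by have [-> ->] := orth_split_uniq UW vU wW v'U w'W e.
Qed.

Lemma glue_set0 : glue_set 0.
Proof. by exists 0, 0; rewrite !rpred0 addr0; split=> //; apply: glued0. Qed.

Lemma glue_setB x y : glue_set x -> glue_set y -> glue_set (x - y).
Proof.
move=> [v [w [vU wW -> h]]] [v' [w' [v'U w'W -> h']]].
exists (v - v'), (w - w'); split; [exact: rpredB | exact: rpredB | |exact: gluedB].
by rewrite opprD addrACA.
Qed.

Lemma glue_setD x y : glue_set x -> glue_set y -> glue_set (x + y).
Proof.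
move=> hx hy; rewrite -[y]opprK; apply: glue_setB => //.
by rewrite -sub0r; apply/glue_setB/hy/glue_set0.
Qed.

Lemma glue_set_left x : glue_set (i x).
Proof.
have ixU := embeds_mem hi x; rewrite -[i x]addr0; apply/glue_setP; rewrite ?rpred0 //.
by apply/(glued_lattice_left (-1) j phi one2 UW hi) => //; exists x.
Qed.

Lemma glue_set_right y : glue_set (j y).
Proof.
have jyW := embeds_mem hj y; rewrite -[j y]add0r; apply/glue_setP; rewrite ?rpred0 //.
by apply/(glued_lattice_right 1 i phi mone2 UW hj) => //; exists y.
Qed.

Lemma glue_set_even : even_set glue_set.
Proof.
move=> z [v [w [vU wW -> h]]].
have [k hk] := glued_norm one2 mone2 UW hi hj (el_even X) (el_even Y) vU wW h.
exists k; rewrite -hk !nformDl !nformDr (nformC w v) (UW.2 v w) // mul1r mulN1r opprK.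
by rewrite addr0 add0r.
Qed.

(** The glue contains its dual. If z = v + w pairs integrally with the glue, then w
    represents a functional on Y, and the glue contains some v0 + w. The difference
    v - v0 pairs integrally with the whole dual of X, because every class of X
    is glued to a class of Y; so it lies in X by biduality. *)
Lemma glue_set_dual z :
  (forall g, glue_set g -> nform z g \is a Num.int) -> glue_set z.
Proof.
move=> hz; have [v [w [vU wW e]]] := UW.1 z.
have wY : exists a, represents (-1) j a w.
  apply: represents_of_int mone2 hj _ _ => y; have := hz _ (glue_set_right y).
  by rewrite e nformDl UW.2 ?add0r //; apply: embeds_mem hj _.
have [v0 v0U h0] := glued_ex_left phi one2 UW hi wY.
have g0 : glue_set (v0 + w) by apply/glue_setP.
have [|x hx] := @bidual _ _ _ _ _ _ i one2 UW hi (v - v0) (rpredB vU v0U).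
  move=> b1 v1 v1U hb1.
  have [w1 w1W h1] := glued_ex_right phi mone2 UW hj (ex_intro _ b1 hb1).
  have g1 : glue_set (v1 + w1) by apply/glue_setP.
  have -> : nform (v - v0) v1 = nform z (v1 + w1) - nform (v0 + w) (v1 + w1).
    rewrite -nformBl e opprD addrACA subrr addr0 nformDr (UW.2 (v - v0) w1) ?addr0 //.
    exact: rpredB.
  apply: rpredB; first exact: hz.
  exact: (even_set_int glue_setB glue_set_even).
have -> : z = (v0 + w) + i x by rewrite -hx e [RHS]addrC addrA subrK.
exact/glue_setD/glue_set_left.
Qed.

(** The glue lies between the lattice spanned by X and Y and the lattice spanned by
    their duals, so it is a full lattice. *)
Lemma glue_narain : exists G : intSubgroup R n, narain G /\
  forall z, z \in int_sub G <-> glue_set z.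
Proof.
have [G hG] := exists_intSubgroup glue_set0 glue_setB
  (even_set_int glue_setB glue_set_even).
exists G; split=> //.
have eG : (fun z => is_true (z \in int_sub G)) = glue_set.
  by apply/funext => z; apply/propext.
have [DU hDU DUP] := dual_lattice_basis one2 UW hi.
have [DW hDW DWP] := dual_lattice_basis mone2 WU hj.
have [bX [_ hBX]] : exists b : 'I_n -> X,
    zbasis b /\ basis_mx U (\matrix_(k < n) i (b k)) by case: hi.
have [bY [_ hBY]] : exists b : 'I_n -> Y,
    zbasis b /\ basis_mx W (\matrix_(k < n) j (b k)) by case: hj.
have [||A hA] := full_lattice_mx glue_set0 glue_setB (basis_mx_col UW hDU hDW).1
  _ (basis_mx_col UW hBX hBY).1.
- move=> z [v [w [vU wW -> [b [a [hb ha _]]]]]].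
  have [c hc] := DUP b; have [d hd] := DWP a.
  have -> : v = rmx c *m DU.
    apply: (represents_uniq one2 UW hi vU _ hb hc).
    by apply/hDU.2; exists (rmx c).
  have -> : w = rmx d *m DW.
    apply: (represents_uniq mone2 WU hj wW _ ha hd).
    by apply/hDW.2; exists (rmx d).
  by exists (row_mx c d); rewrite map_row_mx mul_row_col.
- move=> k; case: (split_ordP k) => l ->.
    by rewrite rowKu rowK; apply: glue_set_left.
  by rewrite rowKd rowK; apply: glue_set_right.
apply: (@narain_criterion _ _ _ A); rewrite ?eG //; first exact: glue_set_even.
move=> z hz; apply/hG/glue_set_dual => g gG; apply: hz; exact/hG.
Qed.

Lemma glue_exists : \dim U = n ->
  exists G : ratNarain U, forall v w, v \in U -> w \in W ->
    v + w \in int_sub G <-> glued v w.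
Proof.
move=> dU; have [G [nG hG]] := glue_narain.
have qB : zmod_morphism (val : subgroup_lattice (inter G U) -> E).
  by move=> x y; rewrite raddfB.
have [|x|y|f hf] := @lat_iso_of_image _ _ 1 U X (subgroup_lattice (inter G U)) i val
  one2 hi qB val_inj.
- by move=> x y; rewrite mul1r; apply/esym/subgroup_formE.
- have h : i x \in int_sub (inter G U).
    by apply/andP; split; [apply/hG/glue_set_left | apply: embeds_mem hi _].
  by exists (exist _ (i x) h).
- have /andP[/hG yG yU] := valP y; rewrite -[val y]addr0 in yG.
  have := (glue_setP yU (rpred0 _)).1 yG.
  move=> /(glued_lattice_left (-1) j phi one2 UW hi yU)[x ->].
  by exists x.
have rG : lat_rank (Gamma_L U G) (\dim U).
  by case: hi => _ _ [b [hb _]]; rewrite dU; exists (f \o b); apply: zbasis_iso.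
exists (RatNarain nG rG) => v w vU wW /=.
by rewrite -glue_setP //; apply: hG.
Qed.

End GlueLattice.

(** * Naturality of gluing *)

Section Naturality.
Variables (R : realType) (n : nat).
Local Notation E := 'rV[R]_(n + n).

Lemma represents_push (X X' : evenLattice) (f : lat_iso X X') e e'
    (i : X -> E) (i' : X' -> E) a v v' :
  (forall x, e' * nform v' (i' (f x)) = e * nform v (i x)) ->
  represents e i a v <-> represents e' i' (dual_push f a) v'.
Proof.
move=> h; split=> [hv y|hv x].
  by rewrite -{2}(li_invK f y) h -hv.
by rewrite -h -hv /= li_funK.
Qed.

Lemma dual_push_surj (X X' : evenLattice) (f : lat_iso X X') (a' : dual X') :
  exists a, a' = dual_push f a.
Proof.
exists (dual_push (lat_iso_inv f : lat_iso X' X) a').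
by apply/val_inj/funext => y; rewrite /= li_invK.
Qed.

Section TwoGluings.
Variables (X Y X' Y' : evenLattice) (f : lat_iso X X') (g : lat_iso Y Y').
Variables (e1 e2 e1' e2' : R).
Variables (i : X -> E) (j : Y -> E) (i' : X' -> E) (j' : Y' -> E).
Variables (phi : disc_iso Y X) (phi' : disc_iso Y' X').

Lemma glued_push v w v' w' :
  (forall x, e1' * nform v' (i' (f x)) = e1 * nform v (i x)) ->
  (forall y, e2' * nform w' (j' (g y)) = e2 * nform w (j y)) ->
  (forall a, phi' (disc_push g a) = disc_push f (phi a)) ->
  glued e1 e2 i j phi v w <-> glued e1' e2' i' j' phi' v' w'.
Proof.
move=> hv hw hphi; split=> [[b [a [hb ha e]]]|[b' [a' [hb ha e]]]].
  exists (dual_push f b), (dual_push g a).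
  split; [exact/(represents_push b hv) | exact/(represents_push a hw) |].
  by rewrite -!disc_pushE hphi e.
have [b eb] := dual_push_surj f b'; have [a ea] := dual_push_surj g a'.
rewrite eb ea in hb ha e; exists b, a.
split; [exact/(represents_push b hv) | exact/(represents_push a hw) |].
by apply: (can_inj (disc_push_inv f)); rewrite -hphi !disc_pushE.
Qed.

(** Each class of Y is represented by some w, which is glued to some v; the images
    of v and w determine their classes, hence the value of [phi']. *)
Lemma push_of_glued (U W : {vspace E}) (h : E -> E) :
  e1 * e1 = 1 -> e2 * e2 = 1 -> orth_split U W -> embeds e1 U i -> embeds e2 W j ->
  (forall v x, v \in U -> e1' * nform (h v) (i' (f x)) = e1 * nform v (i x)) ->
  (forall w y, w \in W -> e2' * nform (h w) (j' (g y)) = e2 * nform w (j y)) ->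
  (forall v w, v \in U -> w \in W ->
     glued e1 e2 i j phi v w -> glued e1' e2' i' j' phi' (h v) (h w)) ->
  forall a, phi' (disc_push g a) = disc_push f (phi a).
Proof.
move=> e1e1 e2e2 UW hi hj hv hw hglue alpha.
have [w wW ha] := represents_ex e2e2 (orth_splitC UW) hj (disc_repr alpha).
have [v vU hb] := represents_ex e1e1 UW hi (disc_repr (phi alpha)).
have [|b' [a' [hb' ha' e]]] := hglue v w vU wW.
  by exists (disc_repr (phi alpha)), (disc_repr alpha); rewrite !disc_reprK.
have hv' x := hv v x vU; have hw' y := hw w y wW.
have eb := represents_fun ((represents_push _ hv').1 hb) hb'.
have ea := represents_fun ((represents_push _ hw').1 ha) ha'.
by rewrite -[alpha]disc_reprK disc_pushE ea e -eb -disc_pushE !disc_reprK.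
Qed.

End TwoGluings.
End Naturality.

(** * The isometry of discriminant groups defined by an overlattice *)

Lemma disc_iso_ext (X Y : preLattice) (phi psi : disc_iso X Y) :
  phi =1 psi -> phi = psi.
Proof.
case: phi => f g fK gK fB fq; case: psi => f' g' f'K g'K f'B f'q /= e.
have ef : f = f' by apply/funext.
subst f'; have eg : g = g' by apply/funext => y; rewrite -{1}[y]g'K fK.
by subst g'; congr DiscIso; apply: Prop_irrelevance.
Qed.

(** By additivity, the two conditions at 0 say that the relation is the graph of a
    bijection. *)
Lemma exists_disc_iso (X Y : preLattice) (rel : disc Y -> disc X -> Prop) :
  (forall a b a' b', rel a b -> rel a' b' -> rel (a - a') (b - b')) ->
  (forall b, rel 0 b -> b = 0) -> (forall a, rel a 0 -> a = 0) ->
  (forall a, exists b, rel a b) -> (forall b, exists a, rel a b) ->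
  (forall a b, rel a b -> disc_q b = disc_q a) ->
  exists phi : disc_iso Y X, forall a b, phi a = b <-> rel a b.
Proof.
move=> relB rel0l rel0r /choice[f hf] /choice[g hg] relq.
have funl a b b' : rel a b -> rel a b' -> b = b'.
  move=> h h'; apply/eqP; rewrite -subr_eq0; apply/eqP/rel0l.
  by rewrite -(subrr a); apply: relB.
have funr a a' b : rel a b -> rel a' b -> a = a'.
  move=> h h'; apply/eqP; rewrite -subr_eq0; apply/eqP/rel0r.
  by rewrite -(subrr b); apply: relB.
have fK : cancel f g by move=> a; apply: (funr _ _ (f a)).
have gK : cancel g f by move=> b; apply: (funl (g b)).
have fB : zmod_morphism f by move=> a a'; apply: (funl (a - a')) => //; apply: relB.
exists (DiscIso fK gK fB (fun a => relq _ _ (hf a))) => a b /=.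
by split=> [<- //|h]; apply: funl h.
Qed.

(** G is an overlattice of X + Y in which X and Y are primitive and whose projections
    to the two dual lattices are onto: every class of one discriminant group is
    then glued to exactly one class of the other. *)
Section GluingMap.
Variables (R : realType) (n : nat).
Local Notation E := 'rV[R]_(n + n).
Variables (e1 e2 : R) (U W : {vspace E}) (X Y : preLattice).
Variables (i : X -> E) (j : Y -> E) (G : E -> Prop).
Hypotheses (e1e1 : e1 * e1 = 1) (e2e2 : e2 * e2 = 1) (UW : orth_split U W).
Hypotheses (hi : embeds e1 U i) (hj : embeds e2 W j).
Hypotheses (evX : even_lattice X) (evY : even_lattice Y).
Hypothesis GB : forall x y, G x -> G y -> G (x - y).
Hypothesis G_left : forall v, v \in U -> G v <-> exists x, v = i x.
Hypothesis G_right : forall w, w \in W -> G w <-> exists y, w = j y.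
Hypothesis G_dual : forall v w, v \in U -> w \in W -> G (v + w) ->
  (exists b, represents e1 i b v) /\ (exists a, represents e2 j a w).
Hypothesis G_lift_left : forall b : dual X,
  exists v w, [/\ v \in U, w \in W, G (v + w) & represents e1 i b v].
Hypothesis G_lift_right : forall a : dual Y,
  exists v w, [/\ v \in U, w \in W, G (v + w) & represents e2 j a w].
Hypothesis G_even : forall v w, v \in U -> w \in W -> G (v + w) ->
  exists k : int, e1 * nform v v - e2 * nform w w = (2 * k)%:~R.

Let WU : orth_split W U := orth_splitC UW.

Definition glue_rel (alpha : disc Y) (beta : disc X) : Prop :=
  exists v w b a, [/\ v \in U, w \in W, G (v + w) &
    [/\ represents e1 i b v, represents e2 j a w, disc_pi a = alpha
      & disc_pi b = beta]].

Lemma exists_gluing : exists phi : disc_iso Y X,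
  forall v w, v \in U -> w \in W -> G (v + w) <-> glued e1 e2 i j phi v w.
Proof.
have G0 : G 0.
  apply/G_left; first exact: rpred0.
  by exists 0; case: hi => /zmod_morphism0->.
have GD x y : G x -> G y -> G (x + y).
  by move=> hx hy; rewrite -[y]opprK; apply: GB => //; rewrite -sub0r; apply: GB.
have [||||||phi hphi] := @exists_disc_iso X Y glue_rel.
- move=> ? ? ? ? [v [w [b [a [vU wW Gvw [hb ha <- <-]]]]]].
  move=> [v' [w' [b' [a' [v'U w'W Gvw' [hb' ha' <- <-]]]]]].
  exists (v - v'), (w - w'), (b - b'), (a - a').
  split; [exact: rpredB | exact: rpredB | |].
    by rewrite addrACA -opprD; apply: GB.
  by split; [exact: representsB | exact: representsB | exact: disc_piB | exact: disc_piB].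
- move=> _ [v [w [b [a [vU wW Gvw [hb ha a0 <-]]]]]].
  have [] := (disc_pi_repr e2e2 WU hj wW (rpred0 _) ha (represents0 _ _)).1.
    by rewrite a0 disc_pi0.
  move=> y; rewrite add0r => ey.
  have Gw : G w by apply/G_right => //; exists y.
  have /(G_left vU)[x ex] : G v by rewrite -(addrK w v); apply: GB.
  rewrite -disc_pi0; apply/(disc_pi_repr e1e1 UW hi vU (rpred0 _) hb (represents0 _ _)).
  by exists x; rewrite add0r.
- move=> _ [v [w [b [a [vU wW Gvw [hb ha <- b0]]]]]].
  have [] := (disc_pi_repr e1e1 UW hi vU (rpred0 _) hb (represents0 _ _)).1.
    by rewrite b0 disc_pi0.
  move=> x; rewrite add0r => ex.
  have Gv : G v by apply/G_left => //; exists x.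
  have /(G_right wW)[y ey] : G w by rewrite -(addKr v w) addrC; apply: GB.
  rewrite -disc_pi0; apply/(disc_pi_repr e2e2 WU hj wW (rpred0 _) ha (represents0 _ _)).
  by exists y; rewrite add0r.
- move=> alpha; have [v [w [vU wW Gvw ha]]] := G_lift_right (disc_repr alpha).
  have [[b hb] _] := G_dual vU wW Gvw.
  by exists (disc_pi b), v, w, b, (disc_repr alpha); rewrite disc_reprK.
- move=> beta; have [v [w [vU wW Gvw hb]]] := G_lift_left (disc_repr beta).
  have [_ [a ha]] := G_dual vU wW Gvw.
  by exists (disc_pi a), v, w, (disc_repr beta), a; rewrite disc_reprK.
- move=> _ _ [v [w [b [a [vU wW Gvw [hb ha <- <-]]]]]].
  have [k hk] := G_even vU wW Gvw; rewrite !disc_qE //; apply/Q2Z_eq; exists k.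
  apply: (fmorph_inj (ratr : {rmorphism rat -> R})).
  rewrite rmorphB /= (dual_norm_repr e1e1 UW hi vU hb).
  by rewrite (dual_norm_repr e2e2 WU hj wW ha) hk ratr_int.
exists phi => v w vU wW; split=> [Gvw|[b [a [hb ha /hphi]]]].
  have [[b hb] [a ha]] := G_dual vU wW Gvw; exists b, a; split=> //.
  by apply/hphi; exists v, w, b, a.
move=> [v' [w' [b' [a' [v'U w'W Gvw' [hb' ha' ea eb]]]]]].
have [x ->] := (disc_pi_repr e1e1 UW hi vU v'U hb hb').1 (esym eb).
have [y ->] := (disc_pi_repr e2e2 WU hj wW w'W ha ha').1 (esym ea).
rewrite addrACA; apply: (GD _ _ Gvw'); apply: GD.
  by apply/G_left; [exact: embeds_mem hi _ | exists x].
by apply/G_right; [exact: embeds_mem hj _ | exists y].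
Qed.

End GluingMap.

(** * Primitive sublattices of a Narain lattice *)

Section Narain.
Variables (R : realType) (n : nat).
Local Notation E := 'rV[R]_(n + n).

Lemma mx_signature_unit m (M : 'M[R]_m) p q : mx_signature M p q -> M \in unitmx.
Proof.
case=> _ [P Pu e]; have : P *m M *m P^T \in unitmx.
  rewrite e unitmxE det_diag unitfE prodf_seq_neq0; apply/allP => k _ /=.
  by rewrite mxE; case: ifP => _; rewrite ?oppr_eq0 oner_neq0.
by rewrite !unitmx_mul unitmx_tr Pu andbT.
Qed.

Lemma val_morphism (G : intSubgroup R n) :
  zmod_morphism (val : subgroup_lattice G -> E).
Proof. by move=> x y; rewrite raddfB. Qed.

Lemma narain_lattice_mx (G : intSubgroup R n) : narain G ->
  exists A : 'M[R]_(n + n), lattice_mx (fun z => z \in int_sub G) A.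
Proof.
case=> _ _ [r [b [hb sg]]]; have er := proj1 sg; subst r.
pose A : 'M[R]_(n + n) := \matrix_k val (b k); exists A.
have Au : A *m nmx R n *m A^T \in unitmx.
  rewrite (_ : _ *m _ = \matrix_(k, l) (pl_form (b k) (b l))%:~R).
    exact: mx_signature_unit sg.
  by apply/matrixP => k l; rewrite gramE !rowK mxE -subgroup_formE.
split; first by rewrite row_free_unit; move: Au; rewrite !unitmx_mul => /andP[/andP[]].
move=> z; split=> [zG|[c ->]].
  exists (zcoord hb (exist _ z zG)).
  exact: (zmod_morphism_rmx hb (@val_morphism G) (exist _ z zG)).
rewrite mulmx_sum_row; apply: rpred_sum => k _; rewrite rowK mxE scaler_int.
by apply/rpredMz/valP.
Qed.

Section Component.
Variables (G : intSubgroup R n) (U : {vspace E}).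
Hypotheses (nG : narain G) (dU : \dim U = n).

Lemma inter_lattice_mx : exists r (B : 'M[R]_(r, n + n)),
  lattice_mx (fun z => z \in int_sub (inter G U)) B.
Proof.
have [A hA] := narain_lattice_mx nG.
have [|||| r [B [_ hB]]] := @sublattice_mx _ _ (fun z => z \in int_sub (inter G U)) _ A.
- exact: rpred0.
- by move=> x y hx hy; apply: rpredB.
- exact: hA.1.
- by move=> z /andP[zG _]; apply/hA.2.
by exists r, B.
Qed.

Lemma inter_lattice_mx_row r (B : 'M[R]_(r, n + n)) k :
  lattice_mx (fun z => z \in int_sub (inter G U)) B -> row k B \in U.
Proof. by move=> hB; have /andP[] := lattice_mx_row hB k. Qed.

Lemma inter_basis_mx (B : 'M[R]_(n, n + n)) :
  lattice_mx (fun z => z \in int_sub (inter G U)) B -> basis_mx U B.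
Proof.
move=> hB; apply: row_free_basis_mx => [|k|]; first exact: hB.1.
  exact: inter_lattice_mx_row.
by rewrite dU.
Qed.

Lemma inter_embeds (B : 'M[R]_(n, n + n)) :
  lattice_mx (fun z => z \in int_sub (inter G U)) B ->
  embeds 1 U (val : subgroup_lattice (inter G U) -> E) /\
  embeds (-1) U (val : lat_opp (subgroup_lattice (inter G U)) -> E).
Proof.
move=> hB; have [b [hb bB]] := lattice_mx_zbasis hB.
have eB : \matrix_k val (b k) = B by apply/row_matrixP => k; rewrite rowK bB.
have hU := inter_basis_mx hB.
split; (split; first exact: val_morphism);
  try (by exists b; split; rewrite ?eB).
  by move=> x y; rewrite mul1r; apply/esym/subgroup_formE.
move=> x y; rewrite mulN1r -[pl_form x y]/(- subgroup_form x y) intrN opprK.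
exact/esym/subgroup_formE.
Qed.

End Component.

Lemma embeds_even eps (U W : {vspace E}) (X : preLattice) (i : X -> E) :
  orth_split U W -> embeds eps U i ->
  (forall x : X, (2 %| pl_form x x)%Z) -> even_lattice X.
Proof.
move=> UW hi ev; split=> //; first by case: hi => _ _ [b [hb _]]; exists n, b.
move=> x hx; apply: (embeds_inj hi); have [iB iform _] := hi.
rewrite (zmod_morphism0 iB); apply: (embeds_eq0 UW hi); first exact: embeds_mem hi _.
by move=> y; rewrite iform hx mulr0.
Qed.

Section Complement.
Variables (G : intSubgroup R n) (U W : {vspace E}).
Hypotheses (nG : narain G) (UW : orth_split U W).
Hypotheses (dU : \dim U = n) (dW : \dim W = n).
Variable B : 'M[R]_(n, n + n).
Hypothesis hB : lattice_mx (fun z => z \in int_sub (inter G U)) B.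

Let WU : orth_split W U := orth_splitC UW.

(** Pairing with a basis of the U-component maps G to Z^n, with kernel the
    W-component. The image is free: the rows of F lift a basis of it, and [kappa]
    gives coordinates in that basis. *)
Lemma complement_of_component : exists k (F : 'M[R]_(k, n + n))
    (kappa : subgroup_lattice G -> 'rV[int]_k),
  [/\ (k <= n)%N, zmod_morphism kappa,
      forall z, val z - rmx (kappa z) *m F \in int_sub (inter G W)
    & forall z, val z \in W -> kappa z = 0].
Proof.
have rowG l : row l B \in int_sub G by have /andP[] := lattice_mx_row hB l.
pose bG l : subgroup_lattice G := exist _ (row l B) (rowG l).
pose psi (z : subgroup_lattice G) : 'rV[int]_n := \row_l pl_form z (bG l).
have psiE z l : (psi z 0 l)%:~R = nform (val z) (row l B).
  by rewrite mxE; apply: subgroup_formE.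
have psiB : zmod_morphism psi by move=> x y; apply/rowP => l; rewrite !mxE pl_formB.
have psi0W z : psi z = 0 -> val z \in W.
  move=> h; apply: (orth_split_mem WU) => u /(inter_basis_mx dU hB).2[c ->].
  rewrite nformC mulmx_sum_row; elim/big_ind: _ => [|x y hx hy|l _].
  - exact: nform0l.
  - by rewrite nformDl hx hy addr0.
  - by rewrite nformZl nformC -psiE h mxE mulr0.
have psiW z : val z \in W -> psi z = 0.
  move=> zW; apply/rowP => l; apply: (@intr_inj R); rewrite psiE mxE.
  by rewrite WU.2 //; apply: inter_lattice_mx_row hB.
have [||k [C [kn HC CH Cf]]] := subgroup_basis R (H := fun c => exists z, c = psi z).
- by exists 0; rewrite (zmod_morphism0 psiB).
- by move=> _ _ [x ->] [y ->]; exists (x - y).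
have /choice[z hz] l : exists z, row l C = psi z.
  by have := HC (delta_mx 0 l); rewrite -rowE.
have /choice[kappa hk] x := CH (psi x) (ex_intro _ x erefl).
have C_inj (c d : 'rV_k) : c *m C = d *m C -> c = d.
  move=> e; apply: (@rmx_inj R); apply: (row_free_inj Cf).
  by rewrite -!map_mxM e.
exists k, (\matrix_l val (z l)), kappa; split=> //.
- by move=> x y; apply: C_inj; rewrite -hk psiB !hk mulmxBl.
- move=> x; pose y := \sum_l z l *~ kappa x 0 l.
  have -> : rmx (kappa x) *m (\matrix_l val (z l)) = val y.
    rewrite (zmod_morphism_sum z (kappa x) (@val_morphism G)) mulmx_sum_row.
    by apply: eq_bigr => l _; rewrite rowK mxE scaler_int.
  rewrite -val_morphism; apply/andP; split; first exact: valP.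
  apply: psi0W; rewrite psiB (zmod_morphism_sum z (kappa x) psiB) hk.
  rewrite mulmx_sum_row -sumrB big1 // => l _.
  by rewrite hz -scaler_int intz subrr.
- by move=> x xW; apply: C_inj; rewrite -hk mul0mx psiW.
Qed.

(** The component in W together with the lifts F generates G, which has rank 2n;
    F has at most n rows, and W has dimension n, so both have n. *)
Lemma complement_lattice_mx : exists B' : 'M[R]_(n, n + n),
  lattice_mx (fun z => z \in int_sub (inter G W)) B'.
Proof.
have [k [F [kappa [kn _ hF _]]]] := complement_of_component.
have [r [B' hB']] := inter_lattice_mx W nG.
have rn : (r <= n)%N.
  by rewrite -dW; apply: (row_free_dim hB'.1) => l; apply: inter_lattice_mx_row hB'.
have [A hA] := narain_lattice_mx nG.
have /choice[c hc] l : exists c, row l A = c *m col_mx B' F.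
  have Gl := lattice_mx_row hA l; pose x : subgroup_lattice G := exist _ (row l A) Gl.
  have /hB'.2[d hd] := hF x; exists (row_mx (rmx d) (rmx (kappa x))).
  by rewrite mul_row_col -hd subrK.
have eA : A = (\matrix_l c l) *m col_mx B' F.
  by apply/row_matrixP => l; rewrite row_mul rowK.
have rk : (n + n <= r + k)%N.
  have /eqP rA := hA.1; rewrite -[X in (X <= _)%N]rA eA.
  by apply: leq_trans (mxrankM_maxr _ _) _; apply: rank_leq_row.
have er : r = n by lia.
by subst r; exists B'.
Qed.

(** Extend f by 0 on the lifts F to a functional on G, which is a pairing by
    unimodularity. *)
Lemma complement_dual (f : subgroup_lattice (inter G W) -> int) :
  zmod_morphism f -> exists2 z, z \in int_sub G &
    forall y : subgroup_lattice (inter G W), (f y)%:~R = nform z (val y).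
Proof.
move=> fB; have [k [F [kappa [_ kB hF k0]]]] := complement_of_component.
pose p (z : subgroup_lattice G) : subgroup_lattice (inter G W) :=
  exist _ (val z - rmx (kappa z) *m F) (hF z).
have pB : zmod_morphism p.
  move=> x y; apply: val_inj; rewrite /= kB map_mxB mulmxBl.
  by rewrite !opprD !opprK addrACA.
have [|a ha] := @mem_dual (subgroup_lattice G) (f \o p).
  by move=> x y; rewrite /= pB fB.
case: nG => _ /(_ a)[z ez] _; exists (val z); first exact: valP.
move=> y; have /andP[yG yW] := valP y.
pose x : subgroup_lattice G := exist _ (val y) yG.
have -> : f y = val a x.
  rewrite ha /=; congr f; apply: val_inj.
  by rewrite /= (k0 x yW) map_mx0 mul0mx subr0.
by rewrite ez; apply: subgroup_formE.
Qed.

End Complement.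
End Narain.

(** * Signatures, embeddings and extension of isometries *)

Section Transport.
Variables (R : realType) (n : nat).
Local Notation E := 'rV[R]_(n + n).

Lemma exists_basis_mx (U : {vspace E}) k : \dim U = k ->
  exists B : 'M[R]_(k, n + n), basis_mx U B.
Proof. by move=> <-; eexists; apply: basis_mx_vbasis. Qed.

Lemma embeds_comp eps eta (U U' : {vspace E}) (X : preLattice) (i : X -> E)
    (h : 'End(E)) :
  embeds eps U i -> injective h -> \dim U' = n ->
  (forall u, u \in U -> h u \in U') ->
  (forall x y, nform (h (i x)) (h (i y)) = eta * nform (i x) (i y)) ->
  embeds (eta * eps) U' (h \o i).
Proof.
move=> hi h_inj dU' hU hform; have [iB iform [b [hb hB]]] := hi.
split; first by move=> x y; rewrite /= iB linearB.
  by move=> x y; rewrite /= hform iform mulrA.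
exists b; split=> //; apply: row_free_basis_mx => [|k|//]; last first.
  by rewrite rowK; apply/hU/(embeds_mem hi).
rewrite -kermx_eq0; apply/eqP/row_matrixP => l; rewrite row0; set c := row l _.
have : c *m (\matrix_(k < n) (h \o i) (b k)) = 0.
  by rewrite /c -row_mul mulmx_ker row0.
have -> : c *m (\matrix_(k < n) (h \o i) (b k)) = h (c *m \matrix_(k < n) i (b k)).
  rewrite !mulmx_sum_row linear_sum; apply: eq_bigr => k _.
  by rewrite linearZ !rowK.
rewrite -(linear0 h) => /h_inj e; apply: (row_free_inj hB.1).
by rewrite e mul0mx.
Qed.

Lemma embeds_precomp eps (U : {vspace E}) (X X' : preLattice) (f : lat_iso X X')
    (i : X' -> E) : embeds eps U i -> embeds eps U (i \o f).
Proof.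
case=> iB iform [b [hb hB]]; split.
- by move=> x y; rewrite /= li_add iB.
- by move=> x y; rewrite /= iform li_form.
exists (lat_iso_inv f \o b); split; first exact: zbasis_iso.
rewrite (_ : (\matrix_(_ < _) _) = \matrix_(k < n) i (b k)) //.
by apply/row_matrixP => k; rewrite !rowK /= li_invK.
Qed.

Lemma embeds_basis_mx eps (U W : {vspace E}) (X : preLattice) (i : X -> E)
    (b : 'I_n -> X) :
  embeds eps U i -> \dim U = n -> zbasis b -> basis_mx U (\matrix_(k < n) i (b k)).
Proof.
move=> hi dU hb; have [iB _ [b0 [hb0 hB0]]] := hi.
apply: row_free_basis_mx => [|k|//]; last by rewrite rowK; apply: embeds_mem hi _.
have e0 : \matrix_(k < n) i (b0 k) =
    (\matrix_k rmx (zcoord hb (b0 k))) *m (\matrix_(k < n) i (b k)).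
  by apply/row_matrixP => k; rewrite row_mul !rowK -(zmod_morphism_rmx hb iB).
rewrite /row_free eqn_leq rank_leq_row; have /eqP r0 := hB0.1.
by rewrite -[X in (X <= _)%N]r0 e0 mxrankM_maxr.
Qed.

Lemma embeds_signature (U : {vspace E}) (X : preLattice) (i : X -> E) p q :
  embeds 1 U i -> \dim U = n ->
  lat_signature R X p q <-> subspace_signature U p q.
Proof.
move=> hi dU; have gram r (b : 'I_r -> X) : \matrix_(k, l) (pl_form (b k) (b l))%:~R =
    (\matrix_k i (b k)) *m nmx R n *m (\matrix_k i (b k))^T.
  by apply/matrixP => k l; rewrite gramE !rowK mxE; case: hi => _ -> _; rewrite mul1r.
split=> [[r [b [hb sg]]]|sg].
  have er : r = n by case: hi => _ _ [b0 [hb0 _]]; apply: zbasis_rank_uniq hb hb0.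
  subst r; have hB := embeds_basis_mx U hi dU hb.
  by apply/(subspace_signatureP p q hB); rewrite ?dU // -gram.
case: (hi) => _ _ [b [hb hB]]; exists n, b; split=> //.
by rewrite gram; apply/(subspace_signatureP p q hB); rewrite ?dU.
Qed.

(** Over R the Gram matrices of X and of a basis of U are congruent to the same
    diagonal matrix; the change of basis M transports a basis of U to one with the
    Gram matrix of X. *)
Lemma embeds_of_signature (U : {vspace E}) (X : preLattice) p q :
  \dim U = n -> lat_rank X n -> lat_signature R X p q ->
  subspace_signature U p q -> exists i : X -> E, embeds 1 U i.
Proof.
move=> dU [b0 hb0] [r [b [hb sX]]] sU.
have er : r = n by apply: zbasis_rank_uniq hb hb0.
subst r; have [B hB] := exists_basis_mx dU.
have := (subspace_signatureP p q hB (esym dU)).1 sU.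
case: sX => _ [P Pu hP] [_ [Q Qu hQ]].
pose M := invmx P *m Q; have Mu : M \in unitmx by rewrite unitmx_mul unitmx_inv Pu.
pose B' := M *m B.
have gram : B' *m nmx R n *m B'^T = \matrix_(k, l) (pl_form (b k) (b l))%:~R.
  have -> : B' *m nmx R n *m B'^T =
      invmx P *m (Q *m (B *m nmx R n *m B^T) *m Q^T) *m (invmx P)^T.
    by rewrite /B' /M !trmx_mul !mulmxA.
  rewrite hQ -hP !mulmxA mulVmx // mul1mx -mulmxA -trmx_mul mulVmx //.
  by rewrite trmx1 mulmx1.
pose i x := rmx (zcoord hb x) *m B'.
have iB : zmod_morphism i by move=> x y; rewrite /i zcoordB map_mxB mulmxBl.
have ib k : i (b k) = row k B'.
  rewrite rowE /i; congr (_ *m _).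
  rewrite -[delta_mx 0 k](_ : rmx (delta_mx 0 k) = _); last first.
    by apply/rowP => l; rewrite !mxE; case: andP.
  congr rmx; rewrite -[RHS](zcoord_uniq hb); congr zcoord.
  rewrite (bigD1 k) //= big1 ?addr0 => [|l lk]; first by rewrite mxE !eqxx.
  by rewrite mxE (negPf lk) andbF.
exists i; split=> //.
  have fB (y : X) : zmod_morphism (fun x : X => (pl_form x y)%:~R : R).
    by move=> ? ?; rewrite pl_formB intrB.
  have gB u : zmod_morphism (fun x => nform (i x) u) by move=> ? ?; rewrite iB nformBl.
  have form_b k l : nform (i (b l)) (i (b k)) = (pl_form (b l) (b k))%:~R.
    by rewrite !ib -gramE gram mxE.
  have form_l k y : nform (i (b k)) (i y) = (pl_form (b k) y)%:~R.
    rewrite nformC pl_formC.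
    exact: (zbasis_ext hb (gB (i (b k))) (fB (b k)) (form_b k) y).
  move=> x y; rewrite mul1r.
  exact: (zbasis_ext hb (gB (i y)) (fB y) (form_l^~ y) x).
exists b; split=> //; rewrite (_ : (\matrix_(_ < _) _) = B'); last first.
  by apply/row_matrixP => k; rewrite rowK ib.
split; first by rewrite row_free_mul ?hB.1 // row_free_unit.
move=> u; rewrite hB.2; split=> -[c ->].
  by exists (c *m invmx M); rewrite mulmxA mulmxKV.
by exists (c *m M); rewrite /B' mulmxA.
Qed.

Lemma in_limg_eq (h : 'End(E)) (U : {vspace E}) : injective h ->
  (forall u, u \in U -> h u \in U) -> (h @: U = U)%VS.
Proof.
move=> /lker0P/eqP h_inj hU; apply/eqP; rewrite eqEdim; apply/andP; split.
  by apply/subvP => _ /memv_imgP[u uU ->]; apply: hU.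
by rewrite limg_dim_eq // h_inj capv0.
Qed.

(** The linear map that sends the bases of X and Y, embedded by i and j, to their
    images under i' and j' is an isometry since all Gram matrices agree. *)
Lemma exists_extension (e1 e2 : R) (U W : {vspace E}) (X Y : preLattice)
    (i i' : X -> E) (j j' : Y -> E) :
  orth_split U W -> embeds e1 U i -> embeds e1 U i' ->
  embeds e2 W j -> embeds e2 W j' ->
  exists h : 'End(E), [/\ forall x y, nform (h x) (h y) = nform x y,
    (h @: U = U)%VS, (h @: W = W)%VS, forall x, h (i x) = i' x
    & forall y, h (j y) = j' y].
Proof.
move=> UW hi hi' hj hj'.
have [iB iform [b [hb hB]]] := hi; have [jB jform [d [hd hD]]] := hj.
set B := (\matrix_(k < n) _) in hB; set D := (\matrix_(k < n) _) in hD.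
pose B' := \matrix_(k < n) i' (b k); pose D' := \matrix_(k < n) j' (d k).
have [i'B i'form _] := hi'; have [j'B j'form _] := hj'.
pose C := col_mx B D; pose C' := col_mx B' D'.
have Cu : C \in unitmx by rewrite -row_free_unit; exact: (basis_mx_col UW hB hD).1.
pose H := invmx C *m C'.
have BH : B *m H = B' /\ D *m H = D'.
  by apply: eq_col_mx; rewrite -mul_col_mx -/C mulmxA mulmxV // mul1mx.
have HJ : H *m nmx R n *m H^T = nmx R n.
  have gram : C' *m nmx R n *m C'^T = C *m nmx R n *m C^T.
    apply/matrixP => k l; rewrite !gramE.
    case: (split_ordP k) => {}k ->; case: (split_ordP l) => {}l ->;
      rewrite ?rowKu ?rowKd !rowK ?i'form ?iform ?j'form ?jform //.
      by rewrite !UW.2 ?(embeds_mem hi, embeds_mem hi', embeds_mem hj, embeds_mem hj').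
    rewrite nformC [RHS]nformC.
    by rewrite !UW.2 ?(embeds_mem hi, embeds_mem hi', embeds_mem hj, embeds_mem hj').
  have -> : H *m nmx R n *m H^T = invmx C *m (C' *m nmx R n *m C'^T) *m (invmx C)^T.
    by rewrite /H trmx_mul !mulmxA.
  rewrite gram !mulmxA mulVmx // mul1mx -mulmxA -trmx_mul mulVmx //.
  by rewrite trmx1 mulmx1.
pose h : 'End(E) := linfun (mulmxr H).
have hE x : h x = x *m H by rewrite lfunE.
have hform x y : nform (h x) (h y) = nform x y.
  by rewrite !hE nform_mul HJ nformE.
have h_inj : injective h.
  move=> x y e; apply/eqP; rewrite -subr_eq0; apply/eqP/nform_nondeg => z.
  by rewrite -hform linearB /= e subrr nform0l.
have hix x : h (i x) = i' x.
  rewrite (zmod_morphism_rmx hb iB) (zmod_morphism_rmx hb i'B) hE -mulmxA.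
  by rewrite -/B BH.1.
have hjy y : h (j y) = j' y.
  rewrite (zmod_morphism_rmx hd jB) (zmod_morphism_rmx hd j'B) hE -mulmxA.
  by rewrite -/D BH.2.
exists h; split=> //; apply: in_limg_eq => // u.
  move=> /hB.2[c ->]; rewrite hE -mulmxA BH.1 mulmx_sum_row.
  by apply: memv_suml => k _; rewrite rowK; apply/memvZ/(embeds_mem hi').
move=> /hD.2[c ->]; rewrite hE -mulmxA BH.2 mulmx_sum_row.
by apply: memv_suml => k _; rewrite rowK; apply/memvZ/(embeds_mem hj').
Qed.

End Transport.

(** * The anti-isometric involution of R^{n,n} *)

Section Sigma.
Variables (R : realType) (n : nat).
Local Notation E := 'rV[R]_(n + n).
Variables (V : {vspace E}) (s : 'Hom(subvs_of V, subvs_of (perp V))).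
Hypotheses (dV : \dim V = n) (capV : (V :&: perp V = 0)%VS) (hs : anti_isometry s).
Local Notation W := (perp V).
Local Notation sigma := (sigma_ext s).

Lemma dim_perp : \dim W = n.
Proof.
have [[t sK tK] _] := hs; have s_inj : injective s by apply: can_inj sK.
transitivity (\dim V) => //.
have := limg_dim_eq (f := s) (U := fullv); rewrite (eqP (introT lker0P s_inj)) capv0.
have -> : limg s = fullv.
  apply/vspaceP => y; rewrite memvf; apply/memv_imgP.
  by exists (t y); rewrite ?memvf ?tK.
by move=> /(_ erefl); rewrite !dimvf.
Qed.

Lemma perp_orth_split : orth_split V W.
Proof.
split=> [x|u w uV /mem_orthovP h]; last by rewrite nformC h.
have : x \in (V + W)%VS.
  suff -> : (V + W)%VS = fullv by rewrite memvf.
  apply/eqP; rewrite eqEdim subvf dimvf dimv_disjoint_sum // dV dim_perp.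
  by rewrite dim_matrix mul1r leqnn.
by case/memv_addP => u uV [w wW ->]; exists u, w.
Qed.

Lemma sigma_linear : linear sigma.
Proof.
move=> a x y; by rewrite /sigma_ext !linearP scalerDr addrACA.
Qed.

Lemma sigma_left v : v \in V -> sigma v = vsval (s (vsproj V v)).
Proof.
move=> vV; rewrite /sigma_ext (daddv_pi_id capV vV).
have -> : daddv_pi W V v = 0.
  have := daddv_pi_add capV (memv_add vV (rpred0 W)).
  rewrite addr0 (daddv_pi_id capV vV) => /(canRL (addKr _)).
  by rewrite addNr.
by rewrite !linear0 add0r.
Qed.

Lemma sigma_right w : w \in W -> sigma w = vsval ((s^-1)%VF (vsproj W w)).
Proof.
have capW : (W :&: V = 0)%VS by rewrite capvC.
move=> wW; rewrite /sigma_ext (daddv_pi_id capW wW).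
have -> : daddv_pi V W w = 0.
  have := daddv_pi_add capW (memv_add wW (rpred0 V)).
  rewrite addr0 (daddv_pi_id capW wW) => /(canRL (addKr _)).
  by rewrite addNr.
by rewrite !linear0 addr0.
Qed.

Lemma sigma_left_mem v : v \in V -> sigma v \in W.
Proof. by move=> vV; rewrite sigma_left // subvsP. Qed.

Lemma sigma_right_mem w : w \in W -> sigma w \in V.
Proof. by move=> wW; rewrite sigma_right // subvsP. Qed.

Lemma s_lker0 : lker s == 0%VS.
Proof. by case: hs => -[t sK _] _; apply/lker0P/(can_inj sK). Qed.

Lemma s_invK : cancel (s^-1)%VF s.
Proof.
move=> y; apply: limg_lfunVK; have [[t sK tK] _] := hs.
by apply/memv_imgP; exists (t y); rewrite ?memvf ?tK.
Qed.

Lemma sigmaD x y : sigma (x + y) = sigma x + sigma y.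
Proof. by have := sigma_linear 1 x y; rewrite !scale1r. Qed.

Lemma sigmaK : involutive sigma.
Proof.
move=> x; have [v [w [vV wW ->]]] := perp_orth_split.1 x.
rewrite (sigmaD v w) (sigmaD (sigma v)).
congr (_ + _).
  rewrite (sigma_right (sigma_left_mem vV)) (sigma_left vV) vsvalK.
  by rewrite lker0_lfunK ?s_lker0 // vsprojK.
rewrite (sigma_left (sigma_right_mem wW)) (sigma_right wW) vsvalK.
by rewrite s_invK vsprojK.
Qed.

Lemma sigma_form x y : nform (sigma x) (sigma y) = - nform x y.
Proof.
have [_ sform] := hs; have VW := perp_orth_split.
have left v v' : v \in V -> v' \in V -> nform (sigma v) (sigma v') = - nform v v'.
  by move=> vV v'V; rewrite !sigma_left // sform !vsprojK.
have right w w' : w \in W -> w' \in W -> nform (sigma w) (sigma w') = - nform w w'.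
  move=> wW w'W; have := left _ _ (sigma_right_mem wW) (sigma_right_mem w'W).
  by rewrite !sigmaK => ->; rewrite opprK.
have [v [w [vV wW ->]]] := VW.1 x; have [v' [w' [v'V w'W ->]]] := VW.1 y.
have o1 : nform (sigma v) (sigma w') = 0.
  by rewrite nformC VW.2 ?sigma_right_mem ?sigma_left_mem.
have o2 : nform (sigma w) (sigma v') = 0.
  by rewrite VW.2 ?sigma_right_mem ?sigma_left_mem.
rewrite (sigmaD v w) (sigmaD v' w').
move: (left _ _ vV v'V) (right _ _ wW w'W) o1 o2.
move: (sigma v) (sigma w) (sigma v') (sigma w') => a b c d ac bd ad bc.
rewrite !nformDl !nformDr ac bd ad bc (VW.2 v w') // (nformC w v') (VW.2 v' w) //.
by move: (nform v v') (nform w w') => p q; ring.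
Qed.

Lemma exists_sigma_lfun : exists S : 'End(E), S =1 sigma.
Proof.
pose F := GRing.isLinear.Build R E E _ sigma sigma_linear.
pose f : {linear E -> E} := HB.pack sigma F.
by exists (linfun f) => x; rewrite lfunE.
Qed.

Lemma embeds_sigma_right (X : preLattice) (i : X -> E) :
  embeds (-1) W i -> embeds 1 V (sigma \o i).
Proof.
move=> hi; have [S hS] := exists_sigma_lfun.
have -> : sigma \o i = S \o i by apply/funext => x /=; rewrite hS.
suff : embeds (-1 * -1) V (S \o i) by rewrite mulrNN mulr1.
apply: embeds_comp hi _ dV _ _ => [x y|w wW|x y]; rewrite ?hS.
- exact: (can_inj sigmaK).
- exact: sigma_right_mem.
- by rewrite mulN1r sigma_form.
Qed.

Lemma embeds_sigma_left (X : preLattice) (i : X -> E) :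
  embeds 1 V i -> embeds (-1) W (sigma \o i).
Proof.
move=> hi; have [S hS] := exists_sigma_lfun.
have -> : sigma \o i = S \o i by apply/funext => x /=; rewrite hS.
suff : embeds (-1 * 1) W (S \o i) by rewrite mulr1.
apply: embeds_comp hi _ dim_perp _ _ => [x y|w wV|x y]; rewrite ?hS.
- exact: (can_inj sigmaK).
- exact: sigma_left_mem.
- by rewrite mulN1r sigma_form.
Qed.

End Sigma.

(** * Sets of classes and of orbits *)

Section Quotients.

Lemma cls_surj (T : Type) (e : T -> T -> Prop) (C : quotient e) :
  exists x, C = cls e x.
Proof. by case: C => C [x hx]; exists x; apply: eq_exist. Qed.

Lemma cls_eqP (T : Type) (e : T -> T -> Prop) x y :
  is_equiv e -> cls e x = cls e y <-> e x y.
Proof.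
case=> er es et; split=> [/(congr1 sval) /= h|exy]; first by rewrite h.
apply: eq_exist; apply/funext => z; apply/propext; split; last exact: et.
by apply/et/es.
Qed.

Lemma quotient_lift (T B : Type) (e : T -> T -> Prop) (f : T -> B) :
  is_equiv e -> (forall x y, e x y -> f x = f y) ->
  exists F : quotient e -> B, forall x, F (cls e x) = f x.
Proof.
move=> he hf; have /choice[r hr] := @cls_surj _ e.
by exists (f \o r) => x /=; apply/hf/(cls_eqP _ _ he); rewrite -hr.
Qed.

Lemma same_orbit_equiv (T : Type) (s : T -> T) :
  involutive s -> is_equiv (same_orbit s).
Proof.
move=> sK; split.
- by move=> x; left.
- by move=> x y [->|->]; [left | right; rewrite sK].
- by move=> x y z [->|->] [->|->]; [left | right | right | left; rewrite sK].
Qed.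

Lemma orbit_lift (S T : Type) (sS : S -> S) (sT : T -> T) (f : S -> T) :
  involutive sS -> involutive sT -> injective f -> (forall x, f (sS x) = sT (f x)) ->
  exists F : orbit_space sS -> orbit_space sT,
    (forall x, F (cls (same_orbit sS) x) = cls (same_orbit sT) (f x)) /\
    injective F.
Proof.
move=> sSK sTK f_inj fs; have eS := same_orbit_equiv sSK.
have eT := same_orbit_equiv sTK.
have [|F hF] := @quotient_lift _ _ _ (fun x => cls (same_orbit sT) (f x)) eS.
  move=> x y [->|->] //; apply/(cls_eqP _ _ eT); right.
  exact: fs.
exists F; split=> // C D; have [x ->] := cls_surj C; have [y ->] := cls_surj D.
rewrite !hF => /(cls_eqP _ _ eT) h; apply/(cls_eqP _ _ eS).
by case: h => [/f_inj->|]; [left | rewrite -fs => /f_inj->; right].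
Qed.

End Quotients.

(** * The triple of a rational Narain lattice *)

Section Main.
Variables (R : realType) (n : nat).
Local Notation E := 'rV[R]_(n + n).
Variables (V : {vspace E}).
Hypotheses (dV : \dim V = n) (dW : \dim (perp V) = n) (VW : orth_split V (perp V)).
Local Notation W := (perp V).
Local Notation valL G := (val : Gamma_L V G -> E).
Local Notation valR G := (val : lat_opp (Gamma_R V G) -> E).

Let one2 : 1 * 1 = 1 :> R. Proof. exact: mulr1. Qed.
Let mone2 : -1 * -1 = 1 :> R. Proof. by rewrite mulrNN mulr1. Qed.
Let WV : orth_split W V := orth_splitC VW.

Lemma exists_signature : exists p q, subspace_signature V p q /\
  forall (X : preLattice) (i : X -> E), embeds 1 V i -> lat_signature R X p q.
Proof.
have [B hB] := exists_basis_mx dV.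
have Gs : (B *m nmx R n *m B^T)^T = B *m nmx R n *m B^T.
  by rewrite !trmx_mul trmxK nmx_tr mulmxA.
have [p [q sg]] := sylvester Gs (basis_gram_unit VW hB).
have sV : subspace_signature V p q by apply/(subspace_signatureP p q hB).
by exists p, q; split=> // X i hi; apply/(embeds_signature p q hi dV).
Qed.

Section OneLattice.
Variable G : ratNarain V.

Lemma lattice_mx_left : exists B : 'M[R]_(n, n + n),
  lattice_mx (fun z => z \in int_sub (inter G V)) B.
Proof.
have [r [B hB]] := inter_lattice_mx V (rn_narain G).
have [b [hb _]] := lattice_mx_zbasis hB.
have [b0 hb0] := rn_rational G.
by have er := zbasis_rank_uniq hb hb0; rewrite dV in er; subst r; exists B.
Qed.

Lemma lattice_mx_right : exists B : 'M[R]_(n, n + n),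
  lattice_mx (fun z => z \in int_sub (inter G W)) B.
Proof.
have [B hB] := lattice_mx_left.
have [B1 hB1] := complement_lattice_mx (rn_narain G) VW dV dW hB. by exists B1.
Qed.

Lemma left_embeds : embeds 1 V (valL G).
Proof. by have [B hB] := lattice_mx_left; case: (inter_embeds dV hB). Qed.

Lemma right_embeds : embeds (-1) W (valR G).
Proof. by have [B hB] := lattice_mx_right; case: (inter_embeds dW hB). Qed.

Lemma inter_even (U : {vspace E}) (x : subgroup_lattice (inter G U)) :
  (2 %| pl_form x x)%Z.
Proof.
have /andP[xG _] := valP x; have [[_ ev _] _ _] := rn_narain G.
exact: (ev (exist _ (val x) xG : subgroup_lattice G)).
Qed.

Lemma left_even : even_lattice (Gamma_L V G).
Proof. exact: embeds_even VW left_embeds (@inter_even V). Qed.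

Lemma right_even : even_lattice (lat_opp (Gamma_R V G)).
Proof.
apply: embeds_even WV right_embeds _ => x.
rewrite -[pl_form x x]/(- subgroup_form x x) rpredN.
exact: (@inter_even W x).
Qed.

Lemma gluingP (phi : disc_iso (lat_opp (Gamma_R V G)) (Gamma_L V G)) :
  gluing phi <-> forall v w, v \in V -> w \in W ->
    v + w \in int_sub G <-> glued 1 (-1) (valL G) (valR G) phi v w.
Proof.
have gE v w : glued 1 (-1) (valL G) (valR G) phi v w <->
    exists (b : dual (Gamma_L V G)) (a : dual (lat_opp (Gamma_R V G))),
      [/\ forall x : Gamma_L V G, (val b x)%:~R = nform v (val x),
          forall y : Gamma_R V G, (val a y)%:~R = - nform w (val y)
        & phi (disc_pi a) = disc_pi b].
  split=> -[b [a [hb ha e]]]; exists b, a; split=> // x.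
  - by rewrite hb mul1r.
  - by rewrite ha mulN1r.
  - by rewrite hb mul1r.
  - by rewrite ha mulN1r.
split=> h v w vV wW.
  exact: iff_trans (h v w vV wW) (iff_sym (gE v w)).
exact: iff_trans (h v w vV wW) (gE v w).
Qed.

Lemma component_dual (U U' : {vspace E}) (x : subgroup_lattice (inter G U)) u u' :
  orth_split U' U -> u' \in U' -> u' + u \in int_sub G ->
  nform u (val x) \is a Num.int.
Proof.
move=> UU u'U uG; have /andP[xG xU] := valP x.
by have := int_subP uG xG; rewrite nformDl UU.2 // add0r.
Qed.

(** Unimodularity of G lifts a functional on one component to an element of G;
    the sign in front of the component in V^perp is absorbed by taking -z. *)
Lemma gluing_exists :
  exists phi : disc_iso (lat_opp (Gamma_R V G)) (Gamma_L V G), gluing phi.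
Proof.
have [BL hBL] := lattice_mx_left; have [BR hBR] := lattice_mx_right.
have [[_ ev _] _ _] := rn_narain G.
have [|||||||phi hphi] := @exists_gluing R n 1 (-1) V W _ _ (valL G) (valR G)
  (fun z => z \in int_sub G) one2 mone2 VW left_embeds right_embeds left_even right_even.
- by move=> x y; apply: rpredB.
- move=> v vV; split=> [vG|[x ->]]; last by have /andP[] := valP x.
  have h : v \in int_sub (inter G V) by apply/andP.
  by exists (exist _ v h).
- move=> w wW; split=> [wG|[y ->]]; last by have /andP[] := valP y.
  have h : w \in int_sub (inter G W) by apply/andP.
  by exists (exist _ w h).
- move=> v w vV wW vwG; split.
    apply: represents_of_int one2 left_embeds _ _ => x.
    by rewrite addrC in vwG; apply: component_dual WV wW vwG.
  apply: represents_of_int mone2 right_embeds _ _ => y.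
  exact: (@component_dual W V y w v VW vV vwG).
- move=> b; have [z zG hz] := complement_dual (rn_narain G) WV dW hBR (dual_morphism b).
  have [v [w [vV wW e]]] := VW.1 z; exists v, w; split=> //; first by rewrite -e.
  move=> x; have /andP[_ xV] := valP x; rewrite mul1r [LHS]hz e nformDl (WV.2 w) //.
  by rewrite addr0.
- move=> a; have [z zG hz] := complement_dual (rn_narain G) VW dV hBL (dual_morphism a).
  have [v [w [vV wW e]]] := VW.1 (- z); exists v, w; split=> //.
    by rewrite -e rpredN.
  move=> y; have /andP[_ yW] := valP y; rewrite mulN1r [LHS]hz -[z]opprK e nformNl.
  by rewrite nformDl (VW.2 v) // add0r.
- move=> v w vV wW vwG.
  have /dvdzP[k hk] := ev (exist _ (v + w) vwG : subgroup_lattice G); exists k.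
  rewrite mul1r mulN1r opprK mulrC -hk [RHS]subgroup_formE /=.
  by rewrite nformDl !nformDr (nformC w v) !(VW.2 v w) // addr0 add0r.
by exists phi; apply/gluingP.
Qed.

End OneLattice.

(** The lattice determines which classes are glued, hence [phi]. *)
Lemma is_gamma_uniq (G : ratNarain V) (T T' : triple R n) :
  is_gamma G T -> is_gamma G T' -> T = T'.
Proof.
move=> [hL [hR [h [phi [/gluingP hphi ->]]]]] [hL' [hR' [h' [phi' [/gluingP hphi' ->]]]]].
rewrite (Prop_irrelevance hL' hL) (Prop_irrelevance hR' hR) in h' *.
rewrite (Prop_irrelevance h' h); congr Triple; apply: disc_iso_ext => alpha.
have [w wW ha] := represents_ex mone2 WV (right_embeds G) (disc_repr alpha).
have hw : exists a, represents (-1) (valR G) a w by exists (disc_repr alpha).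
have [v vV hvw] := glued_ex_left phi one2 VW (left_embeds G) hw.
have [b [a [hb ha1 e1]]] := hvw.
have [b' [a' [hb' ha2 e2]]] := (hphi' v w vV wW).1 ((hphi v w vV wW).2 hvw).
rewrite -[alpha]disc_reprK (represents_fun ha ha1) e1.
by rewrite (represents_fun ha1 ha2) e2 (represents_fun hb hb').
Qed.

(** gamma(G) can be computed from any presentation of G as a glue: the images of X
    and Y are then the components of G. *)
Lemma gamma_of_glued (G : ratNarain V) (T T' : triple R n)
    (i : tX T -> E) (j : tY T -> E) :
  embeds 1 V i -> embeds (-1) W j ->
  (forall v w, v \in V -> w \in W ->
     v + w \in int_sub G <-> glued 1 (-1) i j (tphi T) v w) ->
  is_gamma G T' -> properly_equivalent T T'.
Proof.
move=> hi hj hG [hL [hR [h [phi [/gluingP hphi ->]]]]]; apply/properly_equivalentP.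
have [_ formL _] := left_embeds G; have [_ formR _] := right_embeds G.
have [x|x|f hf] := @lat_iso_of_image _ _ 1 V _ (Gamma_L V G) i (valL G) one2 hi
  (@val_morphism _ _ (inter G V)) val_inj formL.
- have ixV := embeds_mem hi x.
  have ixG : i x \in int_sub G.
    rewrite -[i x]addr0; apply/hG; rewrite ?rpred0 //.
    by apply/(glued_lattice_left (-1) j (tphi T) one2 VW hi ixV); exists x.
  have ixL : i x \in int_sub (inter G V) by apply/andP.
  by exists (exist _ (i x) ixL).
- have /andP[xG xV] := valP x; rewrite -[val x]addr0 in xG.
  have := (hG _ _ xV (rpred0 _)).1 xG.
  by move=> /(glued_lattice_left (-1) j (tphi T) one2 VW hi xV)[y ->]; exists y.
have [y|y|g hg] := @lat_iso_of_image _ _ (-1) W _ (lat_opp (Gamma_R V G)) j (valR G)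
  mone2 hj (@val_morphism _ _ (inter G W)) val_inj formR.
- have jyW := embeds_mem hj y.
  have jyG : j y \in int_sub G.
    rewrite -[j y]add0r; apply/hG; rewrite ?rpred0 //.
    by apply/(glued_lattice_right 1 i (tphi T) mone2 VW hj jyW); exists y.
  have jyR : j y \in int_sub (inter G W) by apply/andP.
  by exists (exist _ (j y) jyR).
- have /andP[yG yW] := valP y; rewrite -[val y]add0r in yG.
  have := (hG _ _ (rpred0 _) yW).1 yG.
  by move=> /(glued_lattice_right 1 i (tphi T) mone2 VW hj yW)[x ->]; exists x.
exists f, g.
apply: (@push_of_glued R n (tX T) (tY T) (EvenLattice hL) (EvenLattice hR) f g
  1 (-1) 1 (-1) i j (valL G) (valR G) (tphi T) phi V W id) => //.
- by move=> v x vV; rewrite hf.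
- by move=> w y wW; rewrite hg.
- by move=> v w vV wW /(hG v w vV wW)/(hphi v w vV wW).
Qed.

End Main.

(** * The correspondence on equivalence classes *)

Lemma glued_swap (R : realType) (n : nat) (e1 e2 : R) (X Y : preLattice)
    (i : X -> 'rV[R]_(n + n)) (j : Y -> 'rV_(n + n)) (phi : disc_iso Y X) v w :
  glued e1 e2 i j phi v w <-> glued e2 e1 j i (disc_iso_inv phi) w v.
Proof.
split=> -[b [a [hb ha e]]]; exists a, b; split=> //=.
  by rewrite -e di_funK.
by rewrite -e /= di_invK.
Qed.

Section Correspondence.
Variables (R : realType) (n : nat).
Local Notation E := 'rV[R]_(n + n).
Variables (V : {vspace E}) (s : 'Hom(subvs_of V, subvs_of (perp V))).
Hypotheses (dV : \dim V = n) (capV : (V :&: perp V = 0)%VS) (hs : anti_isometry s).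
Local Notation W := (perp V).
Local Notation sigma := (sigma_ext s).
Local Notation valL G := (val : Gamma_L V G -> E).
Local Notation valR G := (val : lat_opp (Gamma_R V G) -> E).

Let dW : \dim W = n := dim_perp dV hs.
Let VW : orth_split V W := perp_orth_split dV capV hs.
Let WV : orth_split W V := orth_splitC VW.
Let sK : involutive sigma := sigmaK dV capV hs.
Let sform := sigma_form dV capV hs.

Lemma embeds_lat_rank eps U (X : preLattice) (i : X -> E) :
  embeds eps U i -> lat_rank X n.
Proof. by case=> _ _ [b [hb _]]; exists b. Qed.

Lemma is_gamma_exists (G : ratNarain V) : exists T : triple R n, is_gamma G T.
Proof.
have [p [q [_ sV]]] := exists_signature dV VW.
have hL := left_even dV VW G; have hR := right_even dV dW VW G.
have h : triple_axioms R n (EvenLattice hL) (EvenLattice hR).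
  split; first exact: embeds_lat_rank (left_embeds dV G).
    exact: embeds_lat_rank (right_embeds dV dW VW G).
  exists p, q; split; first exact: sV (left_embeds dV G).
  exact: sV (embeds_sigma_right dV capV hs (right_embeds dV dW VW G)).
have [phi hphi] := gluing_exists dV dW VW G.
by exists (Triple h phi), hL, hR, h, phi.
Qed.

Lemma is_gamma_signature (G : ratNarain V) (T : triple R n) :
  is_gamma G T -> same_signature_as_V V (tX T).
Proof.
move=> [hL [hR [h [phi [_ ->]]]]].
have [p [q [sV sL]]] := exists_signature dV VW; exists p, q; split=> //.
exact: sL (left_embeds dV G).
Qed.

(** Only the real embeddings change, not the lattices. *)
Lemma glued_lat_iso_id (X Y : evenLattice) (phi : disc_iso Y X)
    (e1 e2 e1' e2' : R) (i i' : X -> E) (j j' : Y -> E) v w v' w' :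
  (forall x, e1' * nform v' (i' x) = e1 * nform v (i x)) ->
  (forall y, e2' * nform w' (j' y) = e2 * nform w (j y)) ->
  glued e1 e2 i j phi v w <-> glued e1' e2' i' j' phi v' w'.
Proof.
move=> hv hw.
apply: (glued_push (f := lat_iso_id X) (g := lat_iso_id Y)) => // a.
by have := disc_of_id; rewrite /= => h; rewrite !h.
Qed.

(** G' = g G is the glue of the triple of G embedded through g. *)
Lemma V_equivalent_gamma (G G' : ratNarain V) (T T' : triple R n) :
  is_gamma G T -> is_gamma G' T' -> V_equivalent G G' -> properly_equivalent T T'.
Proof.
move=> [hL [hR [h [phi [/gluingP hphi ->]]]]] gT' [g [gform gV gW] gG].
have g_inj : injective g.
  move=> x y e; apply/eqP; rewrite -subr_eq0; apply/eqP/nform_nondeg => z.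
  by rewrite -gform linearB /= e subrr nform0l.
have gim U u : (g @: U = U)%VS -> u \in U -> exists2 u', u' \in U & u = g u'.
  by move=> eU; rewrite -{1}eU => /memv_imgP.
have gin U u : (g @: U = U)%VS -> u \in U -> g u \in U.
  by move=> eU uU; rewrite -eU; apply: memv_img.
have eL : embeds (1 * 1) V (g \o valL G).
  apply: embeds_comp (left_embeds dV G) g_inj dV _ _ => [u|x y]; first exact: gin.
  by rewrite mul1r gform.
have eR : embeds (1 * -1) W (g \o valR G).
  apply: embeds_comp (right_embeds dV dW VW G) g_inj dW _ _ => [u|x y]; first exact: gin.
  by rewrite mul1r gform.
rewrite !mul1r in eL eR.
apply: (@gamma_of_glued R n V dV dW VW G' (@Triple R n (EvenLattice hL)
  (EvenLattice hR) h phi) T' _ _ eL eR) => //.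
move=> v' w' v'V w'W.
have [v vV ev] := gim _ _ gV v'V; have [w wW ew] := gim _ _ gW w'W.
have -> : v' + w' \in int_sub G' <-> v + w \in int_sub G.
  rewrite gG ev ew -linearD; split=> [[x xG /g_inj->] //|vwG].
  by exists (v + w).
rewrite (hphi _ _ vV wW).
by apply: (@glued_lat_iso_id (EvenLattice hL) (EvenLattice hR)) => ?;
  rewrite /= ?ev ?ew gform.
Qed.

Lemma gamma_V_equivalent (G G' : ratNarain V) (T T' : triple R n) :
  is_gamma G T -> is_gamma G' T' -> properly_equivalent T T' -> V_equivalent G G'.
Proof.
move=> [hL [hR [h [phi [/gluingP hphi ->]]]]].
move=> [hL' [hR' [h' [phi' [/gluingP hphi' ->]]]]] /properly_equivalentP[f [g hfg]].
rewrite /= in f g hfg.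
have [e [eform eV eW eL eR]] := exists_extension VW (left_embeds dV G)
  (embeds_precomp f (left_embeds dV G')) (right_embeds dV dW VW G)
  (embeds_precomp g (right_embeds dV dW VW G')).
have eim U u : (e @: U = U)%VS -> u \in U -> exists2 u', u' \in U & u = e u'.
  by move=> eU; rewrite -{1}eU => /memv_imgP.
have ein U u : (e @: U = U)%VS -> u \in U -> e u \in U.
  by move=> eU uU; rewrite -eU; apply: memv_img.
have memG v w : v \in V -> w \in W ->
    v + w \in int_sub G <-> e (v + w) \in int_sub G'.
  move=> vV wW; rewrite linearD hphi // hphi' ?ein //.
  apply: (@glued_push R n (EvenLattice hL) (EvenLattice hR) (EvenLattice hL')
    (EvenLattice hR') f g) => // x.
    by rewrite -[val (f x)]/((valL G' \o f) x) -eL eform.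
  by rewrite -[val (g x)]/((valR G' \o g) x) -eR eform.
exists e => // z; split=> [zG|[x xG ->]]; last first.
  by have [v [w [vV wW ex]]] := VW.1 x; rewrite ex in xG *; apply/memG.
have [v' [w' [v'V w'W ez]]] := VW.1 z.
have [v vV ev] := eim _ _ eV v'V; have [w wW ew] := eim _ _ eW w'W.
have ezx : z = e (v + w) by rewrite ez ev ew linearD.
by exists (v + w) => //; apply/memG => //; rewrite -ezx.
Qed.

(** X and Y have a common signature, so Y also embeds in V once X does; sigma
    carries it to V^perp and reverses its form. *)
Lemma gamma_surjective (T : triple R n) : same_signature_as_V V (tX T) ->
  exists G : ratNarain V, forall T', is_gamma G T' -> properly_equivalent T T'.
Proof.
move=> [p [q [sX sV]]]; have [rX rY [p' [q' [sX' sY']]]] := tP T.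
have [i hi] := embeds_of_signature dV rX sX sV.
have sV' := (embeds_signature p' q' hi dV).1 sX'.
have [j hj] := embeds_of_signature dV rY sY' sV'.
have hsj := embeds_sigma_left dV capV hs hj.
have [G hG] := glue_exists (tphi T) VW hi hsj dV.
exists G => T'; exact: (@gamma_of_glued R n V dV dW VW G T T' _ _ hi hsj hG).
Qed.

(** sigma G is the glue of G_R(-1) and G_L, embedded through sigma, along the
    inverse isometry. Constructing it as a glue gives at once that it is a rational
    Narain lattice and that its triple is the exchanged one. *)
Lemma sigma_lattice (G : ratNarain V) : exists G' : ratNarain V,
  (forall z, z \in int_sub G' <-> exists2 x, x \in int_sub G & z = sigma x) /\
  forall T T', is_gamma G T -> is_gamma G' T' ->
    properly_equivalent (triple_sigma T) T'.
Proof.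
have [T0 gT0] := is_gamma_exists G.
have [hL [hR [h [phi [/gluingP hphi eT0]]]]] := gT0.
have eL := embeds_sigma_right dV capV hs (right_embeds dV dW VW G).
have eR := embeds_sigma_left dV capV hs (left_embeds dV G).
have [G' hG'] := @glue_exists R n V W (EvenLattice hR) (EvenLattice hL) _ _
  (disc_iso_inv phi) VW eL eR dV.
exists G'; split=> [z|T T' gT]; last first.
  rewrite (is_gamma_uniq dV dW VW gT gT0) eT0.
  exact: (@gamma_of_glued R n V dV dW VW G' (triple_sigma (@Triple R n
    (EvenLattice hL) (EvenLattice hR) h phi)) T' _ _ eL eR hG').
have memG v w : v \in V -> w \in W ->
    v + w \in int_sub G <-> sigma w + sigma v \in int_sub G'.
  move=> vV wW; rewrite hphi // glued_swap hG'; last 2 first.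
  - exact: sigma_right_mem.
  - exact: sigma_left_mem.
  apply: (@glued_lat_iso_id (EvenLattice hR) (EvenLattice hL)) => x;
    by rewrite /= sform ?mulN1r ?mul1r ?opprK.
split=> [zG|[x xG ->]]; last first.
  have [v [w [vV wW ex]]] := VW.1 x; rewrite ex in xG *.
  by rewrite sigmaD addrC; apply/memG.
exists (sigma z); last by rewrite sK.
have [v [w [vV wW ez]]] := VW.1 z; rewrite ez sigmaD addrC; apply/memG.
- exact: sigma_right_mem.
- exact: sigma_left_mem.
- by rewrite !sK -ez.
Qed.

End Correspondence.

Theorem theorem3p12 (R : realType) (n : nat)
    (V : {vspace 'rV[R]_(n + n)})
    (s : 'Hom(subvs_of V, subvs_of (perp V))) :
  (1 <= n)%N -> \dim V = n -> (V :&: perp V = 0)%VS -> anti_isometry s ->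
  exists gamma : ratNarain V -> triple R n,
    (forall G T, is_gamma G T <-> T = gamma G) /\
  exists gamma_bar : Rbar V -> Tbar R n,
    (forall G, gamma_bar (Rclass G) = Tclass (gamma G)) /\
    injective gamma_bar /\
    (forall c : Tbar R n, (exists C, gamma_bar C = c) <->
      exists2 T : triple R n, c = Tclass T & same_signature_as_V V (tX T)) /\
  exists (sigma_R : ratNarain V -> ratNarain V)
         (sigma_Rbar : Rbar V -> Rbar V),
    (forall G z, z \in int_sub (sigma_R G) <->
      exists2 x, x \in int_sub G & z = sigma_ext s x) /\
    (forall G, sigma_Rbar (Rclass G) = Rclass (sigma_R G)) /\
    involutive sigma_Rbar /\
  exists gamma_orb : orbit_space sigma_Rbar ->
                     orbit_space (@Tbar_sigma R n),
    (forall C, gamma_orb (cls (same_orbit sigma_Rbar) C) =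
               cls (same_orbit Tbar_sigma) (gamma_bar C)) /\
    injective gamma_orb.
Proof.
move=> _ dV capV hs.
have dW := dim_perp dV hs; have VW := perp_orth_split dV capV hs.
have /choice[gamma hgamma] := is_gamma_exists dV capV hs.
have eT := @properly_equivalent_equiv R n; have [Trefl Tsym Ttrans] := eT.
have VE G G' : V_equivalent G G' <-> properly_equivalent (gamma G) (gamma G').
  split; first exact: (V_equivalent_gamma dV capV hs (hgamma G) (hgamma G')).
  exact: (gamma_V_equivalent dV capV hs (hgamma G) (hgamma G')).
have eR : is_equiv (@V_equivalent R n V).
  split=> [G|G G' /VE h|G G' G'' /VE h /VE h']; apply/VE.
  - exact: Trefl.
  - exact: Tsym.
  - exact: Ttrans h h'.
have gammaP G T : is_gamma G T <-> T = gamma G.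
  split=> [h|-> //]; exact: (is_gamma_uniq dV dW VW h (hgamma G)).
exists gamma; split=> //.
have [|gbar hgbar] := @quotient_lift _ _ _ (fun G => Tclass (gamma G)) eR.
  by move=> G G' /VE h; apply/(cls_eqP _ _ eT).
have gbar_inj : injective gbar.
  move=> C D; have [G ->] := cls_surj C; have [G' ->] := cls_surj D.
  by rewrite !hgbar => /(cls_eqP _ _ eT)/VE h; apply/(cls_eqP _ _ eR).
exists gbar; split=> //; split=> //; split=> [c|].
  split=> [[C <-]|[T -> sT]].
    have [G ->] := cls_surj C; exists (gamma G); first exact: hgbar.
    exact: (is_gamma_signature dV capV hs (hgamma G)).
  have [G hG] := gamma_surjective dV capV hs sT; exists (Rclass G).
  by rewrite hgbar; apply/(cls_eqP _ _ eT)/Tsym/hG.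
have /choice[sR hsR] := sigma_lattice dV capV hs.
have sgamma G : Tbar_sigma (Tclass (gamma G)) = Tclass (gamma (sR G)).
  rewrite /Tclass /Tbar_sigma quotient_mapE; apply/(cls_eqP _ _ eT).
  exact: (hsR G).2.
have [|sbar hsbar] := @quotient_lift _ _ _ (fun G => Rclass (sR G)) eR.
  move=> G G' /VE h; apply/(cls_eqP _ _ eR)/VE/(cls_eqP _ _ eT).
  rewrite -![cls _ (gamma _)]/(Tclass _) -!sgamma; congr Tbar_sigma.
  exact/(cls_eqP _ _ eT).
have sTK : involutive (@Tbar_sigma R n).
  move=> c; have [T ->] := cls_surj c; rewrite /Tbar_sigma !quotient_mapE.
  apply/(cls_eqP _ _ eT)/properly_equivalentP; exists (lat_iso_id _), (lat_iso_id _) => a.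
  by rewrite !disc_of_id.
have gs C : gbar (sbar C) = Tbar_sigma (gbar C).
  by have [G ->] := cls_surj C; rewrite hsbar !hgbar sgamma.
have sbarK : involutive sbar by move=> C; apply: gbar_inj; rewrite !gs sTK.
exists sR, sbar; split; first by move=> G; apply: (hsR G).1.
split=> //; split=> //.
exact: orbit_lift sbarK sTK gbar_inj gs.
Qed.
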